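(* Let $T\subset\mathbb{R}^3$ be a polyhedron and $k\ge0$ an integer. For the operator $Q_h^{(3)}$, the $L^2$ projection $Q_h^{(4)}$ from $L^2(T)$ onto $V_k^{(4)}(T)=P_k(T)$, and the weak divergence $\nabla_w\cdot: V_k^{(3)}(T)\to V_k^{(4)}(T)$, $$\nabla_w\cdot(Q_h^{(3)}\mathbf{w})=Q_h^{(4)}(\nabla\cdot\mathbf{w})\qquad\forall\mathbf{w}\in H(\mathrm{div};T)\cap[C(T)]^3.$$
   Context: Geometry and notation. $T\subset\mathbb{R}^3$ is a (closed, bounded) polyhedron with flat polygonal faces, each edge being shared by exactly two faces; $C(T)$ is the space of continuous functions on the closed region $T$. $F(T)$ is its set of faces. $P_j(D)$ is the space of polynomials of total degree at most $j$ on $D$. $(\cdot,\cdot)_D$ is the $L^2$ inner product on $D$. $\mathbf{n}$ is the unit outward normal on $\partial T$; $\mathbf{n}_f$ is a fixed unit normal to the face $f$. Spaces. $V_{k,0}^{(3)}(T)=[P_k(T)]^3$, $V_{k,f}^{(3)}(f)=\{w_f\mathbf{n}_f: w_f\in P_k(f)\}$, $V_k^{(3)}(T)=\{\mathbf{w}=\{\mathbf{w}_0,\mathbf{w}_f\}: \mathbf{w}_0\in V_{k,0}^{(3)}(T),\mathbf{w}_f\in V_{k,f}^{(3)}(f), f\in F(T)\}$, $V_k^{(4)}(T)=P_k(T)$. Weak divergence. For $\mathbf{w}=\{\mathbf{w}_0,\mathbf{w}_f\}\in V_k^{(3)}(T)$, $\nabla_w\cdot\mathbf{w}\in V_k^{(4)}(T)$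 is determined by $$(\nabla_w\cdot\mathbf{w},\tau)_T=-(\mathbf{w}_0,\nabla\tau)_T+(\mathbf{w}_f,\tau\mathbf{n})_{\partial T}\quad\forall\tau\in V_k^{(4)}(T).$$ Projection. For $\mathbf{w}\in H(\mathrm{div};T)\cap[C(T)]^3$, $Q_h^{(3)}\mathbf{w}=\{Q_0^{(3)}\mathbf{w},\,Q_f^{(3)}((\mathbf{w}|_f\cdot\mathbf{n}_f)\mathbf{n}_f)\}\in V_k^{(3)}(T)$, where $Q_0^{(3)},Q_f^{(3)}$ are the $L^2$ projections onto $V_{k,0}^{(3)}(T)$, $V_{k,f}^{(3)}(f)$. *)

(* Defs.v *)
From HB Require Import structures.
From mathcomp Require Import all_boot all_order all_algebra.
From mathcomp Require Import all_classical all_reals all_analysis.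
(* The notations of mpoly clash with those of mathcomp-analysis. *)
From mathcomp Require Import -(notations) mpoly.

Set Implicit Arguments.
Unset Strict Implicit.
Unset Printing Implicit Defensive.

Import Order.TTheory GRing.Theory Num.Theory.
Import numFieldNormedType.Exports.

Local Open Scope classical_set_scope.
Local Open Scope ring_scope.

Notation E3 R := (R * R * R)%type.

Section Euclidean.
Context {R : realType}.
Implicit Types a b x : E3 R.

Definition dot a b : R := a.1.1 * b.1.1 + a.1.2 * b.1.2 + a.2 * b.2.

Definition cross a b : E3 R :=
  (a.1.2 * b.2 - a.2 * b.1.2,
   a.2 * b.1.1 - a.1.1 * b.2,
   a.1.1 * b.1.2 - a.1.2 * b.1.1).

Definition segment a b : set (E3 R) :=
  [set (1 - t) *: a + t *: b | t in `[0%R, 1%R]].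

Definition leb2 := (@lebesgue_measure R \x @lebesgue_measure R)%E.
Definition leb3 :=
  (@lebesgue_measure R \x @lebesgue_measure R \x @lebesgue_measure R)%E.

Definition grad (u : E3 R -> R) x : E3 R :=
  ('D_(1, 0, 0) u x, 'D_(0, 1, 0) u x, 'D_(0, 0, 1) u x).

Definition iter_derive (vs : seq (E3 R)) (u : E3 R -> R) : E3 R -> R :=
  foldr (fun v f x => 'D_v f x) u vs.

Definition smooth (u : E3 R -> R) : Prop :=
  forall vs x, differentiable (iter_derive vs u) x.

End Euclidean.

Section Polyhedron.
Variable R : realType.

(* A flat polygonal face, given in an orthonormal frame (fu, fv) of its plane;
   the frame is oriented so that cross fu fv is the normal pointing outward
   from the polyhedron (see ph_outward below). *)
Record face := Face {
  fo : E3 R;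
  fu : E3 R;
  fv : E3 R;
  fdom : set (R * R);
  fu_unit : dot fu fu = 1;
  fv_unit : dot fv fv = 1;
  fuv_orth : dot fu fv = 0;
  fdom_compact : compact fdom;
  fdom_neq0 : fdom !=set0;
  fdom_regular : closure (fdom°) = fdom }.

Definition chart (f : face) (z : R * R) : E3 R :=
  fo f + z.1 *: fu f + z.2 *: fv f.

Definition face_set (f : face) : set (E3 R) := chart f @` fdom f.

Definition face_bound (f : face) : set (E3 R) :=
  chart f @` (fdom f `\` (fdom f)°).

Definition outward (f : face) : E3 R := cross (fu f) (fv f).

Definition unit_normal (f : face) (nu : E3 R) : Prop :=
  [/\ dot nu nu = 1, dot nu (fu f) = 0 & dot nu (fv f) = 0].

Record polyhedron := Polyhedron {
  region :> set (E3 R);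
  nfaces : nat;
  ph_face : 'I_nfaces -> face;
  nedges : nat;
  ph_edge : 'I_nedges -> E3 R * E3 R;
  ph_compact : compact region;
  ph_neq0 : region !=set0;
  ph_regular : closure (region°) = region;
  ph_boundary : region `\` region° = \bigcup_i face_set (ph_face i);
  ph_faces_meet : forall i j, i != j ->
    face_set (ph_face i) `&` face_set (ph_face j) `<=` face_bound (ph_face i);
  ph_outward : forall i z, (fdom (ph_face i))° z ->
    \forall t \near (0 : R)^'+,
      region° (chart (ph_face i) z - t *: outward (ph_face i)) /\
      ~ region (chart (ph_face i) z + t *: outward (ph_face i));
  ph_edge_neq : forall e, (ph_edge e).1 != (ph_edge e).2;
  ph_edges_meet : forall e e', e != e' ->
    segment (ph_edge e).1 (ph_edge e).2 `&`
      segment (ph_edge e').1 (ph_edge e').2 `<=`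
    [set (ph_edge e).1; (ph_edge e).2] `&`
      [set (ph_edge e').1; (ph_edge e').2];
  ph_polygonal : forall i, face_bound (ph_face i) =
    \bigcup_(e in [set e | segment (ph_edge e).1 (ph_edge e).2
                             `<=` face_set (ph_face i)])
      segment (ph_edge e).1 (ph_edge e).2;
  ph_two_faces : forall e,
    #|[pred i | `[< segment (ph_edge e).1 (ph_edge e).2
                      `<=` face_set (ph_face i) >]]| = 2%N }.

End Polyhedron.

Section Spaces.
Context {R : realType}.
Implicit Types (D : set (E3 R)) (T : polyhedron R) (f : face R).
Implicit Types (nu x : E3 R).

Definition coord x (i : 'I_3) : R := nth 0 [:: x.1.1; x.1.2; x.2] i.

(* mmeasure mdeg p is what mpoly writes msize p: 1 + the total degree of p, or 0
   if p = 0. *)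
Definition polyfun (k : nat) : set (E3 R -> R) :=
  [set u | exists2 p : mpoly 3 R,
     (mmeasure mdeg p <= k.+1)%N & u = fun x => meval (coord x) p].

(* Functions on D are represented by functions on R^3 vanishing outside D. *)
Definition Pk (k : nat) D : set (E3 R -> R) :=
  [set u \_ D | u in polyfun k].

Definition ip D (u v : E3 R -> R) : R :=
  \int[leb3]_(x in D) (u x * v x).

Definition ipv D (u v : E3 R -> E3 R) : R :=
  \int[leb3]_(x in D) dot (u x) (v x).

(* The chart of f is an isometry, so this is the integral over f with respect
   to surface area. *)
Definition ipf f (u v : E3 R -> E3 R) : R :=
  \int[leb2]_(z in fdom f) dot (u (chart f z)) (v (chart f z)).

Definition ipb T (u : 'I_(nfaces T) -> E3 R -> E3 R)
    (v : 'I_(nfaces T) -> E3 R -> E3 R) : R :=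
  \sum_i ipf (ph_face i) (u i) (v i).

Definition L2 D : set (E3 R -> R) := [set u | u \_ D \in Lfun leb3 2%:E].

(* The element of V characterized by the orthogonality relations; it exists and
   is unique for the finite-dimensional spaces V used below. *)
Definition L2proj (F : pointedType) (inner : F -> F -> R) (V : set F)
    (w : F) : F :=
  get [set q | V q /\ forall v, V v -> inner q v = inner w v].

Definition V0 (k : nat) T : set (E3 R -> E3 R) :=
  [set w | [/\ Pk k T (fun x => (w x).1.1), Pk k T (fun x => (w x).1.2)
             & Pk k T (fun x => (w x).2)]].

Definition Vf (k : nat) f nu : set (E3 R -> E3 R) :=
  [set w | exists2 u, Pk k (face_set f) u & w = fun x => u x *: nu].

Definition V4 (k : nat) T : set (E3 R -> R) := Pk k T.

Definition weak_field T : Type :=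
  ((E3 R -> E3 R) * ('I_(nfaces T) -> E3 R -> E3 R))%type.

Definition V3 (k : nat) T (nu : 'I_(nfaces T) -> E3 R) :
    set (weak_field T) :=
  [set w | V0 k T w.1 /\ forall i, Vf k (ph_face i) (nu i) (w.2 i)].

(* tau ranges over polynomials on R^3, so that grad tau is also defined at
   the points of the boundary of T. *)
Definition weak_div (k : nat) T (w : weak_field T) : E3 R -> R :=
  get [set d | V4 k T d /\ forall tau, polyfun k tau ->
    ip T d tau = - ipv T w.1 (grad tau)
      + ipb w.2 (fun i x => tau x *: outward (ph_face i))].

Definition Qh3 (k : nat) T (nu : 'I_(nfaces T) -> E3 R)
    (w : E3 R -> E3 R) : weak_field T :=
  (L2proj (ipv T) (V0 k T) w,
   fun i => L2proj (ipf (ph_face i)) (Vf k (ph_face i) (nu i))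
              (fun x => dot (w x) (nu i) *: nu i)).

Definition Qh4 (k : nat) T : (E3 R -> R) -> E3 R -> R :=
  L2proj (ip T) (V4 k T).

Definition test_fun T : set (E3 R -> R) :=
  [set phi | [/\ smooth phi, compact (closure [set x | phi x != 0])
               & closure [set x | phi x != 0] `<=` T°]].

Definition is_div T (w : E3 R -> E3 R) (g : E3 R -> R) : Prop :=
  L2 T g /\ forall phi, test_fun T phi -> ip T g phi = - ipv T w (grad phi).

Definition Hdiv T : set (E3 R -> E3 R) :=
  [set w | [/\ L2 T (fun x => (w x).1.1), L2 T (fun x => (w x).1.2),
               L2 T (fun x => (w x).2) & exists g, is_div T w g]].

(* A representative of the L2 class of the distributional divergence. *)
Definition divL2 T (w : E3 R -> E3 R) : E3 R -> R := get (is_div T w).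

End Spaces.

(* Main.v *)
(* Green's formula
     (div w, tau)_T = - (w, grad tau)_T + sum_f (tau, w . n)_f
   holds for every polynomial tau when w is continuous with a square integrable
   distributional divergence. To see this, test div w with tau * chi_m, where
   chi_m is a product over the faces f of cutoffs 1 - b (h / eps_m) * E_m: here
   h is the signed distance to the plane of f, b is a bump function, and E_m is
   a smooth function of the foot point, equal to 1 near f and tending to 0 off f.
   The cutoffs vanish near the boundary, so that tau * chi_m cut to T is a test
   function, and chi_m -> 1 inside T. Rescaling the distance to the plane of f
   by eps_m turns the term w . grad of the cutoff of f into an integral which
   converges, by dominated convergence, to the flux of w through f: the
   derivative of b has integral 1 on the negative half line, and edges are null
   sets, so that the other cutoffs can be taken to be 1 in the limit.
   For tau in P_k, grad tau is in [P_k]^3 and tau * n is a polynomial of degree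
   at most k times nu_f (as n = +- nu_f), so w may be replaced by its
   projections: the weak divergence of Q_h w and the projection of div w are
   characterized by the same relations. *)

(* [ph_outward] is a pointwise condition: above a point of the relative interior of a face, the
   normal segment is inside [T] up to a length that depends on the point, without a uniform collar.
   Hence the flux is computed in coordinates stretched by the thickness, where the integrands of all
   m live in one fixed cube and pointwise convergence off a null set is enough. The gradient of E_m
   grows without control as its transition narrows, so eps_m is chosen after E_m, small enough that
   eps_m times this gradient tends to 0. Test functions must have derivatives of all orders; these
   are handled by an inductive class of functions closed under directional derivatives, and cutting
   such a function to [T] keeps it smooth when it vanishes near the boundary. On the algebraic side,
   both members of the final equality are picked by [get] from sets of functions, so it reduces to
   an equality of two sets. The projections inside [Qh3], in contrast, have to be shown to exist;
   this is Gram-Schmidt for a form treated as merely semidefinite. *)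
From HB Require Import structures.
From mathcomp Require Import all_boot all_order all_algebra.
From mathcomp Require Import all_classical all_reals all_analysis.
From mathcomp Require Import measurable_realfun.
From mathcomp Require Import ring lra.
Require Import Defs.
Set Implicit Arguments.
Unset Strict Implicit.
Unset Printing Implicit Defensive.

Import Order.TTheory GRing.Theory Num.Theory.
Import numFieldNormedType.Exports.

Local Open Scope classical_set_scope.
Local Open Scope ring_scope.

(** * Affine changes of variables *)

Section ChangeOfVariables.
Context {R : realType}.
Local Notation leb := (@lebesgue_measure R).
Local Notation M := (measurableTypeR R).
Local Notation M3 := (M * M * M)%type.

(** Lebesgue measure is the only measure with the right value on half-open intervals, and [|t|]
    times its image under the affine map has these values. *)
Lemma ge0_integral_affine (t s : R) (F : R -> \bar R) :
  t != 0 -> measurable_fun [set: R] F -> (forall x, 0 <= F x)%E ->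
  (\int[leb]_x F x = `|t|%:E * \int[leb]_x F (t * x + s)%R)%E.
Proof.
move=> t0 mF F0.
pose phi : R -> R := fun x => t * x + s.
have mphi : measurable_fun [set: measurableTypeR R] (phi : measurableTypeR R -> measurableTypeR R).
  by apply: measurable_funD => //; apply: measurable_funM.
have nt0 : 0 <= `|t| by [].
pose mu0 : {measure set (measurableTypeR R) -> \bar R} :=
  measure_function_pushforward__canonical__measure_function_Measure leb mphi.
pose mu1 := mscale (NngNum nt0) mu0.
have Hmu : forall A, measurable A -> leb A = mu1 A.
  apply: lebesgue_measure_unique => X [[a b] /= _ <-].
rewrite /mu1/= /mscale /= /mu0/= /pushforward /=.
  set P := _ @^-1` _.
  (* A decreasing map turns a left-open, right-closed interval into a left-closed, right-open one,
     of the same measure. *)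
  have -> : P = if 0 < t then `]((a - s)/t), ((b - s)/t)]%classic
                else `[((b - s)/t), ((a - s)/t)[%classic.
    apply/seteqP; rewrite /P; case: ifPn => ht; split => x /=; rewrite !in_itv /= /phi.
    - by rewrite ltr_pdivrMr// ler_pdivlMr//; move=> /andP[? ?]; apply/andP; lra.
    - by rewrite ltr_pdivrMr// ler_pdivlMr//; move=> /andP[? ?]; apply/andP; lra.
    - have tn : t < 0 by rewrite lt_neqAle t0 leNgt.
      by rewrite ltr_ndivlMr// ler_ndivrMr//; move=> /andP[? ?]; apply/andP; lra.
    - have tn : t < 0 by rewrite lt_neqAle t0 leNgt.
      by rewrite ltr_ndivlMr// ler_ndivrMr//; move=> /andP[? ?]; apply/andP; lra.
  case: ifPn => ht; rewrite !lebesgue_measure_itv /= !lte_fin.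
  - rewrite ltr_pM2r ?invr_gt0// ltrD2r.
    case: ifPn => _; last by rewrite mule0.
    rewrite gtr0_norm// -EFinB -!EFinM; congr EFin; field.
    by rewrite gt_eqF.
  - have tn : t < 0 by rewrite lt_neqAle t0 leNgt.
    rewrite ltr_nM2r ?invr_lt0// ltrD2r.
    case: ifPn => _; last by rewrite mule0.
    rewrite ltr0_norm// -EFinB -!EFinM; congr EFin; field.
    by rewrite lt_eqF.
rewrite (eq_measure_integral mu1); last by move=> A mA _; exact: Hmu.
rewrite ge0_integral_mscale//=; congr (_ * _)%E.
by rewrite ge0_integral_pushforward.
Qed.

Definition det3 (a b c : E3 R) : R := dot a (cross b c).

(** Made a property of the three columns, so that it can be carried along column operations.
    Nonnegative integrands let Tonelli apply at each operation. *)
Definition change_var (a b c : E3 R) := forall (o : E3 R) (F : E3 R -> \bar R),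
  measurable_fun [set: M3] F -> (forall x, 0 <= F x)%E ->
  (\int[leb3]_x F x =
   `|det3 a b c|%:E * \int[leb3]_y F (o + y.1.1 *: a + y.1.2 *: b + y.2 *: c)%R)%E.

Lemma E3_eq (x y : E3 R) : x.1.1 = y.1.1 -> x.1.2 = y.1.2 -> x.2 = y.2 -> x = y.
Proof. by case: x => -[x1 x2] x3; case: y => -[y1 y2] y3 /= -> -> ->. Qed.

Lemma measurable_E3 d (X : measurableType d) (f g h : X -> R) :
  measurable_fun setT f -> measurable_fun setT g -> measurable_fun setT h ->
  measurable_fun setT (fun x => (f x, g x, h x) : E3 R).
Proof.
by move=> mf mg mh; apply: measurable_fun_pair => //; exact: measurable_fun_pair.
Qed.

Lemma measurable_c1 D : measurable_fun D (fun x : E3 R => x.1.1).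
Proof.
apply: measurable_funTS; exact: (measurableT_comp (@measurable_fst _ _ R R)).
Qed.
Lemma measurable_c2 D : measurable_fun D (fun x : E3 R => x.1.2).
Proof.
apply: measurable_funTS; exact: (measurableT_comp (@measurable_snd _ _ R R)).
Qed.
Lemma measurable_c3 D : measurable_fun D (fun x : E3 R => x.2).
Proof. by apply: measurable_funTS; exact: measurable_snd. Qed.

Lemma measurable_lin (o a b c : E3 R) :
  measurable_fun setT (fun y : E3 R => o + y.1.1 *: a + y.1.2 *: b + y.2 *: c).
Proof.
rewrite (_ : (fun _ => _) = fun y : E3 R =>
  (o.1.1 + y.1.1 * a.1.1 + y.1.2 * b.1.1 + y.2 * c.1.1,
   o.1.2 + y.1.1 * a.1.2 + y.1.2 * b.1.2 + y.2 * c.1.2,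
   o.2 + y.1.1 * a.2 + y.1.2 * b.2 + y.2 * c.2)); last exact/funext.
have m1 := @measurable_c1 setT; have m2 := @measurable_c2 setT.
have m3 := @measurable_c3 setT.
by apply: measurable_E3; do ![apply: measurable_funD => //|apply: measurable_funM => //].
Qed.

Lemma leb2_sigma_finite :
  sigma_finite [set: M * M] (leb2 : {measure set (M * M)%type -> \bar R}).
Proof.
have /sigma_finiteP[F [TF ndF Foo]] := @sigma_finiteT _ _ _ leb.
exists (fun n => F n `*` F n).
  rewrite -setXTT TF predeqE => -[x y]; split; last first.
    by move=> [n _ []/= ? ?]; split; exists n.
  move=> [/= [n _ Fnx] [k _ Fky]]; exists (maxn n k) => //; split.
  - by move: x Fnx; exact/subsetPset/ndF/leq_maxl.
  - by move: y Fky; exact/subsetPset/ndF/leq_maxr.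
move=> k; have [? ?] := Foo k; split; first exact: measurableX.
by rewrite [ltLHS]product_measure1E// lte_mul_pinfty// ge0_fin_numE.
Qed.

(* The \x of two sigma-finite measures has no canonical sigma-finite
   instance, as the subprobability instance takes its place. *)
HB.instance Definition _ := Measure.on (leb2 : set (M * M)%type -> \bar R).
HB.instance Definition _ :=
  Measure_isSigmaFinite.Build _ _ _ (leb2 : set (M * M)%type -> \bar R) leb2_sigma_finite.
Definition leb2sf : {sigma_finite_measure set (M * M)%type -> \bar R} := leb2.

Lemma tonelli21 (F : E3 R -> \bar R) :
  measurable_fun [set: M3] F -> (forall x, 0 <= F x)%E ->
  (\int[leb3]_x F x = \int[leb2sf]_z \int[leb]_r F (z, r))%E.
Proof. exact: (@fubini_tonelli1 _ _ _ _ _ leb2sf leb). Qed.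

Lemma tonelli3 (F : E3 R -> \bar R) :
  measurable_fun [set: M3] F -> (forall x, 0 <= F x)%E ->
  (\int[leb3]_x F x = \int[leb]_p \int[leb]_q \int[leb]_r F (p, q, r))%E.
Proof.
move=> mF F0; rewrite tonelli21//.
pose G := fubini_F leb F.
have mG : measurable_fun [set: (M * M)%type] G.
  by apply: measurable_fun_fubini_tonelli_F.
have G0 x : (0 <= G x)%E by apply: integral_ge0 => y _; exact: F0.
exact: (@fubini_tonelli1 _ _ _ _ _ leb leb G mG G0).
Qed.

Lemma measurable_sect3 (F : E3 R -> \bar R) p q :
  measurable_fun [set: M3] F -> measurable_fun setT (fun r => F (p, q, r)).
Proof. by move=> mF; apply: (measurableT_comp mF); exact: measurable_E3. Qed.

Lemma leb3_swap12 (F : E3 R -> \bar R) :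
  measurable_fun [set: M3] F -> (forall x, 0 <= F x)%E ->
  (\int[leb3]_x F x = \int[leb3]_x F (x.1.2, x.1.1, x.2))%E.
Proof.
move=> mF F0.
have m1 := @measurable_c1 setT; have m2 := @measurable_c2 setT.
have mG : measurable_fun setT (fun x : E3 R => F (x.1.2, x.1.1, x.2)).
  by apply: (measurableT_comp mF); exact: measurable_E3.
rewrite (tonelli21 mF F0) (tonelli21 mG (fun x => F0 _)).
pose G := fubini_F leb F.
have mG' : measurable_fun [set: (M * M)%type] G.
  by apply: measurable_fun_fubini_tonelli_F.
have G0 x : (0 <= G x)%E by apply: integral_ge0 => y _; exact: F0.
rewrite [LHS](@fubini_tonelli2 _ _ _ _ _ leb leb G mG' G0).
have mH : measurable_fun [set: (M * M)%type] (fun z : R * R => G (z.2, z.1)).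
  by apply: (measurableT_comp mG'); exact: measurable_fun_pair.
have H0 (x : R * R) : (0 <= G (x.2, x.1))%E by [].
by rewrite [RHS](@fubini_tonelli1 _ _ _ _ _ leb leb _ mH H0).
Qed.

Lemma leb3_swap23 (F : E3 R -> \bar R) :
  measurable_fun [set: M3] F -> (forall x, 0 <= F x)%E ->
  (\int[leb3]_x F x = \int[leb3]_x F (x.1.1, x.2, x.1.2))%E.
Proof.
move=> mF F0.
have m1 := @measurable_c1 setT; have m2 := @measurable_c2 setT.
have mG : measurable_fun setT (fun x : E3 R => F (x.1.1, x.2, x.1.2)).
  by apply: (measurableT_comp mF); exact: measurable_E3.
rewrite (tonelli3 mF F0) (tonelli3 mG (fun x => F0 _)); apply: eq_integral => p _ /=.
pose f (x : R * R) := F (p, x.1, x.2).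
have mf : measurable_fun setT f.
  apply: (measurableT_comp mF); apply: measurable_E3.
  - exact: measurable_cst.
  - exact: measurable_fst.
  - exact: measurable_snd.
exact: (@fubini_tonelli _ _ _ _ _ leb leb f mf (fun x => F0 _)).
Qed.

(** With the first two coordinates frozen, this is the affine substitution on the line, made in the
    inner integral. *)
Lemma leb3_shear (t al be ga : R) (F : E3 R -> \bar R) :
  t != 0 -> measurable_fun [set: _] F -> (forall x, 0 <= F x)%E ->
  (\int[leb3]_x F x =
    `|t|%:E * \int[leb3]_x F (x.1.1, x.1.2, t * x.2 + (al * x.1.1 + be * x.1.2 + ga))%R)%E.
Proof.
move=> t0 mF F0.
have m1 := @measurable_c1 setT; have m2 := @measurable_c2 setT.
have mG : measurable_fun setT (fun x : E3 R => F (x.1.1, x.1.2, t * x.2 + (al * x.1.1 + be * x.1.2 + ga))).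
  apply: (measurableT_comp mF); apply: measurable_E3 => //.
  by do ![apply: measurable_funD => //|apply: measurable_funM => //].
rewrite (tonelli21 mF F0) (tonelli21 mG (fun x => F0 _)) -ge0_integralZl//; last 2 first.
- exact: (@measurable_fun_fubini_tonelli_F _ _ _ _ _ leb _ mG (fun x => F0 _)).
- by move=> x _; apply: integral_ge0 => y _; exact: F0.
apply: eq_integral => -[p q] _ /=.
by rewrite (ge0_integral_affine (al * p + be * q + ga) t0)//; exact: measurable_sect3.
Qed.

Lemma det3E a b c : det3 a b c =
  a.1.1 * (b.1.2 * c.2 - b.2 * c.1.2) + a.1.2 * (b.2 * c.1.1 - b.1.1 * c.2)
  + a.2 * (b.1.1 * c.1.2 - b.1.2 * c.1.1).
Proof. by []. Qed.

Lemma change_var_swap12 a b c : change_var a b c -> change_var b a c.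
Proof.
move=> P o F mF F0; rewrite (P o F mF F0); congr (_ * _)%E.
  by congr EFin; rewrite -normrN; congr Num.norm; rewrite !det3E; ring.
rewrite (leb3_swap12 (measurableT_comp mF (measurable_lin o a b c)) (fun x => F0 _)).
by apply: eq_integral => x _ /=; rewrite (addrAC o).
Qed.

Lemma change_var_swap23 a b c : change_var a b c -> change_var a c b.
Proof.
move=> P o F mF F0; rewrite (P o F mF F0); congr (_ * _)%E.
  by congr EFin; rewrite -normrN; congr Num.norm; rewrite !det3E; ring.
rewrite (leb3_swap23 (measurableT_comp mF (measurable_lin o a b c)) (fun x => F0 _)).
by apply: eq_integral => x _ /=; rewrite (addrAC (o + _)).
Qed.

Lemma change_var_shear a b c (t al be : R) : t != 0 ->
  change_var a b c -> change_var (a + al *: c) (b + be *: c) (t *: c).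
Proof.
move=> t0 P o F mF F0; rewrite (P o F mF F0).
have -> : `|det3 (a + al *: c) (b + be *: c) (t *: c)| = `|det3 a b c| * `|t|.
  rewrite -normrM; congr Num.norm; rewrite !det3E /= /GRing.scale /=; ring.
rewrite EFinM -muleA; congr (_ * _)%E.
rewrite (leb3_shear al be 0 t0 (measurableT_comp mF (measurable_lin o a b c)) (fun x => F0 _)).
congr (_ * _)%E; apply: eq_integral => x _; congr F => /=.
by apply: E3_eq; rewrite /= /GRing.scale /=; ring.
Qed.

Lemma leb3_shift3 (s : R) (F : E3 R -> \bar R) :
  measurable_fun [set: M3] F -> (forall x, 0 <= F x)%E ->
  (\int[leb3]_x F x = \int[leb3]_x F (x.1.1, x.1.2, (x.2 + s)%R))%E.
Proof.
move=> mF F0; rewrite (leb3_shear 0 0 s (oner_neq0 R) mF F0) normr1 mul1e.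
by apply: eq_integral => x _; rewrite !mul0r !add0r mul1r.
Qed.

(** This is translation invariance. Only shifts of the last coordinate are available at this point,
    so each coordinate is swapped into the last slot, shifted there and swapped back. *)
Lemma change_var_id : change_var (1, 0, 0) (0, 1, 0) (0, 0, 1).
Proof.
move=> o F mF F0.
have -> : det3 (1, 0, 0) (0, 1, 0) (0, 0, 1) = 1 by rewrite det3E /=; ring.
rewrite normr1 mul1e.
have m1 := @measurable_c1 setT; have m2 := @measurable_c2 setT.
have m3 := @measurable_c3 setT.
have ms (i j k : E3 R -> R) : measurable_fun [set: M3] i ->
    measurable_fun [set: M3] j -> measurable_fun [set: M3] k ->
    measurable_fun [set: M3] (fun x => F (i x, j x, k x)).
  by move=> mi mj mk; apply: (measurableT_comp mF); exact: measurable_E3.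
have mo (c : R) (i : E3 R -> R) : measurable_fun [set: M3] i ->
    measurable_fun [set: M3] (fun x => i x + c).
  by move=> mi; apply: measurable_funD.
rewrite (leb3_shift3 o.2 mF F0).
have h3 := ms _ _ _ m1 m2 (mo o.2 _ m3).
rewrite (leb3_swap23 h3 (fun x => F0 _)) /=.
have h2 := ms _ _ _ m1 m3 (mo o.2 _ m2).
rewrite (leb3_shift3 o.1.2 h2 (fun x => F0 _)) /=.
have h1 := ms _ _ _ m1 (mo o.1.2 _ m3) (mo o.2 _ m2).
rewrite (leb3_swap12 h1 (fun x => F0 _)) /=.
have h4 := ms _ _ _ m2 (mo o.1.2 _ m3) (mo o.2 _ m1).
rewrite (leb3_swap23 h4 (fun x => F0 _)) /=.
have h5 := ms _ _ _ m3 (mo o.1.2 _ m2) (mo o.2 _ m1).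
rewrite (leb3_shift3 o.1.1 h5 (fun x => F0 _)) /=.
have h6 := ms _ _ _ (mo o.1.1 _ m3) (mo o.1.2 _ m2) (mo o.2 _ m1).
rewrite (leb3_swap23 h6 (fun x => F0 _)) /=.
have h7 := ms _ _ _ (mo o.1.1 _ m2) (mo o.1.2 _ m3) (mo o.2 _ m1).
rewrite (leb3_swap12 h7 (fun x => F0 _)) /=.
have h8 := ms _ _ _ (mo o.1.1 _ m1) (mo o.1.2 _ m3) (mo o.2 _ m2).
rewrite (leb3_swap23 h8 (fun x => F0 _)) /=.
apply: eq_integral => x _; congr F.
by apply: E3_eq; rewrite /= /GRing.scale /=; ring.
Qed.

(** The inverse of a column operation is one of the same kind. Used backwards this is an elimination
    step: the triple left to treat is simpler. *)
Lemma change_var_unshear a b c (t al be : R) : t != 0 ->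
  change_var (a + al *: c) (b + be *: c) (t *: c) -> change_var a b c.
Proof.
move=> t0 /(@change_var_shear _ _ _ t^-1 (- al / t) (- be / t)).
rewrite invr_eq0 => /(_ t0); congr (change_var _ _ _); apply: E3_eq;
  by rewrite /= /GRing.scale /=; field.
Qed.

Lemma change_var_perm312 a b c : change_var a b c -> change_var c a b.
Proof. by move=> /change_var_swap23/change_var_swap12. Qed.
Lemma change_var_perm231 a b c : change_var a b c -> change_var b c a.
Proof. by move=> /change_var_swap12/change_var_swap23. Qed.

(** Last stage of a Gaussian elimination whose stages are proved in reverse order: [change_var1]
    uses the pivot [c.1.1], [change_var2] the pivot [b.1.2], and here the pivot [a.2] clears the
    rest, leaving a permuted standard basis. *)
Let change_var3 a b c : a.1 = (0, 0) -> b.1 = (0, 1) -> c.1 = (1, 0) ->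
  a.2 != 0 -> change_var a b c.
Proof.
move=> a1 b1 c1 a2; apply: change_var_perm312; apply: (@change_var_unshear _ _ _ a.2^-1 (- b.2 / a.2) (- c.2 / a.2)).
  by rewrite invr_neq0.
suff -> : change_var (b + (- b.2 / a.2) *: a) (c + (- c.2 / a.2) *: a) (a.2^-1 *: a)
   = change_var (0, 1, 0) (1, 0, 0) (0, 0, 1) by apply: change_var_swap12; exact: change_var_id.
by congr (change_var _ _ _); apply: E3_eq; rewrite /= ?a1 ?b1 ?c1 /GRing.scale /=; field.
Qed.

Let change_var2 a b c : a.1.1 = 0 -> b.1.1 = 0 -> c.1 = (1, 0) ->
  b.1.2 != 0 -> det3 a b c != 0 -> change_var a b c.
Proof.
move=> a1 b1 c1 b2 d; apply: change_var_swap23.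
set t := b.1.2^-1; set al := - a.1.2 / b.1.2.
apply: (@change_var_unshear _ _ _ t al 0); first by rewrite /t invr_neq0.
apply: change_var_swap23; apply: change_var3.
- by apply/pair_equal_spec; rewrite /= a1 b1 /GRing.scale /= /al; split; by field.
- by apply/pair_equal_spec; rewrite /= b1 /GRing.scale /= /t; split; by field.
- by apply/pair_equal_spec; rewrite /= b1 c1 /GRing.scale /=; split; ring.
- move: d; apply: contra => /eqP /=; rewrite /GRing.scale /= /al => h.
  rewrite det3E a1 b1 c1 /=.
  have -> : a.2 = a.1.2 / b.1.2 * b.2 by move: h; lra.
  by apply/eqP; field.
Qed.

Let change_var1 a b c : c.1.1 != 0 -> det3 a b c != 0 -> change_var a b c.
Proof.
move=> c1 d.
wlog ab : a b c c1 d / a.1.1 = 0 /\ b.1.1 = 0 /\ c.1.1 = 1.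
  move=> H; apply: (@change_var_unshear _ _ _ c.1.1^-1 (- a.1.1 / c.1.1) (- b.1.1 / c.1.1)).
    by rewrite invr_neq0.
  apply: H.
  - by rewrite /= /GRing.scale /= mulVf// oner_neq0.
  - suff -> : det3 (a + (- a.1.1 / c.1.1) *: c) (b + (- b.1.1 / c.1.1) *: c) (c.1.1^-1 *: c)
       = c.1.1^-1 * det3 a b c by rewrite mulf_neq0// invr_neq0.
    by rewrite !det3E /= /GRing.scale /=; field.
  - by rewrite /= /GRing.scale /=; split; [|split]; by field.
case: ab => a1 [b1 c11].
(* If [a.1.2] and [b.1.2] were both 0, [a] and [b] would both be along the third axis and the
   determinant would vanish. *)
wlog b2 : a b d a1 b1 / b.1.2 != 0.
  move=> H; have [b0|b0] := eqVneq b.1.2 0; last exact: H.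
  apply: change_var_swap12; apply: H => //.
    suff -> : det3 b a c = - det3 a b c by rewrite oppr_eq0.
    by rewrite !det3E; ring.
  apply: contra d => /eqP a0; rewrite det3E a1 b1 b0 a0.
  by apply/eqP; ring.
apply: change_var_perm231; apply: (@change_var_unshear _ _ _ 1 (- c.1.2 / b.1.2) 0); first exact: oner_neq0.
rewrite scale0r addr0 scale1r; apply: change_var_perm312; apply: change_var2 => //.
- by apply/pair_equal_spec; rewrite /= b1 c11 /GRing.scale /=; split; by field.
- suff -> : det3 a b (c + (- c.1.2 / b.1.2) *: b) = det3 a b c by [].
  by rewrite !det3E /= /GRing.scale /=; field.
Qed.

(** Some column has a nonzero first coordinate; a cyclic permutation makes it the third column,
    where the elimination expects its first pivot. *)
Lemma change_var_det a b c : det3 a b c != 0 -> change_var a b c.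
Proof.
move=> d.
have [a1|a1] := eqVneq a.1.1 0; last first.
  apply: change_var_perm312; apply: change_var1 => //.
  by suff -> : det3 b c a = det3 a b c by []; rewrite !det3E; ring.
have [b1|b1] := eqVneq b.1.1 0; last first.
  apply: change_var_perm231; apply: change_var1 => //.
  by suff -> : det3 c a b = det3 a b c by []; rewrite !det3E; ring.
apply: change_var1 => //; apply: contra d => /eqP c1.
by apply/eqP; rewrite det3E a1 b1 c1; ring.
Qed.

End ChangeOfVariables.

(** * Smooth cutoff functions *)

Section FlatExponential.
Context {R : realType}.

(** The powers of [x^-1] are there to make the family stable under differentiation: the derivative
    of the member [n] combines the members [n.+1] and [n.+2]. *)
Definition flat_exp (n : nat) (x : R) : R :=
  if 0 < x then x^-1 ^+ n * expR (- x^-1) else 0.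

(** The exponential at [x^-1] is at least the term of degree [n.+2] of its series. The quadratic
    decay gives the derivative 0 at the origin. *)
Lemma flat_exp_le (n : nat) (x : R) : 0 < x ->
  flat_exp n x <= n.+2`!%:R * x ^+ 2.
Proof.
move=> x0; rewrite /flat_exp x0 expRN ler_pdivrMr ?expR_gt0//.
have xi : 0 <= x^-1 by rewrite invr_ge0 ltW.
have := expR_ge1Dxn n.+1 xi.
have f0 : (0 : R) < n.+2`!%:R by rewrite ltr0n fact_gt0.
move=> /(le_trans (ler_wpDl ler01 (lexx _))); rewrite ler_pdivrMr// => H.
rewrite mulrAC; have x2 : 0 < x ^+ 2 by rewrite exprn_gt0.
rewrite -ler_pdivrMr//.
apply: le_trans (_ : x^-1 ^+ n.+2 <= _).
  by rewrite -exprVn -exprD addn2.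
by rewrite mulrC.
Qed.

Lemma flat_exp_ge0 n x : 0 <= flat_exp n x.
Proof.
rewrite /flat_exp; case: ifPn => // x0.
by rewrite mulr_ge0// ?expR_ge0// exprn_ge0// invr_ge0 ltW.
Qed.

Lemma flat_exp0 n x : x <= 0 -> flat_exp n x = 0.
Proof. by rewrite /flat_exp leNgt => /negbTE ->. Qed.

Lemma flat_exp_gt0 n x : 0 < x -> 0 < flat_exp n x.
Proof. by move=> x0; rewrite /flat_exp x0 mulr_gt0 ?expR_gt0// exprn_gt0// invr_gt0. Qed.

Lemma is_derive_flat_exp n (x : R) :
  is_derive x 1 (flat_exp n) (flat_exp n.+2 x - n%:R * flat_exp n.+1 x).
Proof.
have [x0|x0|->] := ltrgtP x 0.
- rewrite !flat_exp0 ?ltW// mulr0 subr0.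
  apply: near_eq_is_derive (is_derive_cst 0 x 1) => //.
  near=> t; rewrite flat_exp0// ltW//; near: t; exact: lt_nbhsl.
- have E : is_derive x 1 (fun t => t^-1 ^+ n * expR (- t^-1))
     (flat_exp n.+2 x - n%:R * flat_exp n.+1 x).
    have xn0 : x != 0 by rewrite gt_eqF.
    have iv : is_derive x 1 (fun t : R => t^-1) (- x ^- 2).
      have : derivable (fun t : R => t^-1) x 1 by apply: derivableV.
      move/derivableP; rewrite deriveV// derive_id; congr (is_derive _ _ _ _).
      by rewrite /GRing.scale /= mulr1.
    have iN : is_derive x 1 (fun t : R => - t^-1) (x ^- 2).
      by have := is_deriveN iv; rewrite opprK.
    have ie : is_derive x 1 (fun t : R => expR (- t^-1)) (x ^- 2 * expR (- x^-1)).
      by have := @is_derive1_comp _ expR (fun t : R => - t^-1) x _ _ (is_derive_expR (- x^-1)) iN; rewrite mulrC.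
    have E0 := is_deriveM (is_deriveX n iv) ie.
    have -> : (fun t : R => t^-1 ^+ n * expR (- t^-1)) =
        (fun t : R => t^-1) ^+ n * (fun t : R => expR (- t^-1)).
      by apply/funext => t; rewrite !fctE.
    apply: is_derive_eq E0 _; rewrite !fctE /flat_exp x0 /GRing.scale /=.
    have -> : x ^- 2 = x^-1 ^+ 2 by rewrite exprVn.
    by case: n => [|n]; rewrite ?expr0 ?mul0r ?mulrS /= !exprS; ring.
  apply: near_eq_is_derive E => //.
  near=> t; rewrite /flat_exp ifT//; near: t.
  by apply: open_nbhs_nbhs; split => //; exact: open_gt.
- rewrite !flat_exp0// mulr0 subr0.
  (* At the origin the difference quotient vanishes for negative increments and, by [flat_exp_le],
     is at most a constant times [h] for positive ones. *)
  have H : h^-1 *: ((flat_exp n \o shift 0) (h *: 1) - flat_exp n 0)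
     @[h --> (0 : R)^'] --> (0 : R).
    apply/cvgr0Pnorm_lt => e e0.
    near=> h; rewrite /= addr0 (flat_exp0 n (lexx 0)) subr0 /GRing.scale /= mulr1.
    have [h0|h0] := lerP h 0; first by rewrite flat_exp0// mulr0 normr0.
    rewrite ger0_norm ?mulr_ge0 ?invr_ge0 ?flat_exp_ge0 ?ltW//.
    rewrite mulrC ltr_pdivrMr//; apply: le_lt_trans (flat_exp_le n h0) _.
    rewrite expr2 mulrA ltr_pM2r//.
    have f0 : (0 : R) < n.+2`!%:R by rewrite ltr0n fact_gt0.
    rewrite mulrC -ltr_pdivlMr//; apply: le_lt_trans (ler_norm h) _.
    near: h; apply: dnbhs0_lt; exact: divr_gt0.
  apply: DeriveDef; first by apply/cvg_ex; exists 0.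
  exact: cvg_lim.
Unshelve. all: by end_near. Qed.

(* A class of functions closed under the operations used to build cutoffs and
   under directional derivatives, hence made of smooth functions. *)
Inductive elementary (V : normedModType R) : (V -> R) -> Prop :=
| elementary_cst c : elementary (fun=> c)
| elementary_lin (f : {linear V -> R}) : continuous f -> elementary f
| elementaryD f g : elementary f -> elementary g ->
    elementary (fun x => f x + g x)
| elementaryM f g : elementary f -> elementary g ->
    elementary (fun x => f x * g x)
| elementaryV f : (forall x, f x != 0) -> elementary f ->
    elementary (fun x => (f x)^-1)
| elementary_flat_exp n f : elementary f ->
    elementary (fun x => flat_exp n (f x)).

Section Elementary.
Variable V : normedModType R.
Implicit Types (f g : V -> R) (v x : V).

Lemma differentiable_flat_exp n (t : R) : differentiable (flat_exp n) t.
Proof. by apply/derivable1_diffP; case: (is_derive_flat_exp n t). Qed.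

Lemma eq_elementary g f : elementary g -> f =1 g -> elementary f.
Proof. by move=> eg /funext ->. Qed.

Lemma differentiable_elementary f x : elementary f -> differentiable f x.
Proof.
move=> ef; elim: ef x => {f}.
- by move=> c x; exact: differentiable_cst.
- by move=> f cf x; exact: linear_differentiable.
- by move=> f g _ df _ dg x; exact: differentiableD.
- by move=> f g _ df _ dg x; exact: differentiableM.
- by move=> f f0 _ df x; exact: differentiableV.
- move=> n f _ df x; apply: (@differentiable_comp _ _ _ _ f (flat_exp n)) => //.
  exact: differentiable_flat_exp.
Qed.

Lemma derivable_elementary f x v : elementary f -> derivable f x v.
Proof. by move=> ef; apply: diff_derivable; exact: differentiable_elementary. Qed.

Lemma continuous_elementary f : elementary f -> continuous f.
Proof.
by move=> ef x; apply: differentiable_continuous; exact: differentiable_elementary.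
Qed.

Lemma derive_lin (f : {linear V -> R}) x v : continuous f -> 'D_v f x = f v.
Proof.
by move=> cf; rewrite deriveE ?diff_lin//; exact: linear_differentiable.
Qed.

Lemma derive_comp1 (h : R -> R) f x v : derivable h (f x) 1 ->
  differentiable f x -> 'D_v (fun y => h (f y)) x = 'D_1 h (f x) * 'D_v f x.
Proof.
move=> dh df; have dh' : differentiable h (f x) by exact/derivable1_diffP.
rewrite (@deriveE _ _ _ (fun y => h (f y))); last exact: differentiable_comp.
rewrite (@diff_comp _ _ _ _ f h)//= deriv1E//= -deriveE// derive1E mulrC.
by rewrite /GRing.scale.
Qed.

(** Each differentiation rule stays within the constructors; for [flat_exp] the index rises.
    Iterating this gives derivatives of all orders. *)
Lemma elementary_derive f v : elementary f -> elementary (fun x => 'D_v f x).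
Proof.
elim => {f}.
- move=> c; apply: (@eq_elementary (fun=> 0)); first exact: elementary_cst.
  by move=> x; exact: derive_cst.
- move=> f cf; apply: (@eq_elementary (fun=> f v)); first exact: elementary_cst.
  by move=> x; exact: derive_lin.
- move=> f g ef edf eg edg.
  apply: (@eq_elementary (fun x => 'D_v f x + 'D_v g x)).
    exact: elementaryD.
  by move=> x; rewrite deriveD//; exact: derivable_elementary.
- move=> f g ef edf eg edg.
  apply: (@eq_elementary (fun x => f x * 'D_v g x + g x * 'D_v f x)).
    by apply: elementaryD; exact: elementaryM.
  by move=> x; rewrite deriveM//; exact: derivable_elementary.
- move=> f f0 ef edf.
  apply: (@eq_elementary (fun x => -1 * ((f x)^-1 * (f x)^-1) * 'D_v f x)).
    apply: elementaryM => //; apply: elementaryM; first exact: elementary_cst.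
    by apply: elementaryM; exact: elementaryV.
  move=> x; rewrite deriveV//; last exact: derivable_elementary.
  by rewrite /GRing.scale/= mulN1r -invfM -expr2.
- move=> n f ef edf.
  apply: (@eq_elementary (fun x =>
    (flat_exp n.+2 (f x) + - n%:R * flat_exp n.+1 (f x)) * 'D_v f x)).
    apply: elementaryM => //; apply: elementaryD; first exact: elementary_flat_exp.
    by apply: elementaryM; [exact: elementary_cst|exact: elementary_flat_exp].
  move=> x; have [dh Dh] := is_derive_flat_exp n (f x).
  by rewrite derive_comp1// ?Dh ?mulNr//; exact: differentiable_elementary.
Qed.

Lemma elementaryB f g : elementary f -> elementary g ->
  elementary (fun x => f x - g x).
Proof.
move=> ef eg; apply: (@eq_elementary (fun x => f x + -1 * g x)).
  by apply: elementaryD => //; apply: elementaryM => //; exact: elementary_cst.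
by move=> x; rewrite mulN1r.
Qed.

Lemma elementary_sum I (s : seq I) (P : pred I) (F : I -> V -> R) :
  (forall i, P i -> elementary (F i)) ->
  elementary (fun x => \sum_(i <- s | P i) F i x).
Proof.
move=> eF; elim: s => [|i s IH].
  apply: (@eq_elementary (fun=> 0)); first exact: elementary_cst.
  by move=> x; rewrite big_nil.
have [Pi|Pi] := boolP (P i); last first.
  apply: (@eq_elementary (fun x => \sum_(i <- s | P i) F i x)) => //.
  by move=> x; rewrite big_cons (negbTE Pi).
apply: (@eq_elementary (fun x => F i x + \sum_(i <- s | P i) F i x)).
  by apply: elementaryD => //; exact: eF.
by move=> x; rewrite big_cons Pi.
Qed.

Lemma elementary_prod I (s : seq I) (P : pred I) (F : I -> V -> R) :
  (forall i, P i -> elementary (F i)) ->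
  elementary (fun x => \prod_(i <- s | P i) F i x).
Proof.
move=> eF; elim: s => [|i s IH].
  apply: (@eq_elementary (fun=> 1)); first exact: elementary_cst.
  by move=> x; rewrite big_nil.
have [Pi|Pi] := boolP (P i); last first.
  apply: (@eq_elementary (fun x => \prod_(i <- s | P i) F i x)) => //.
  by move=> x; rewrite big_cons (negbTE Pi).
apply: (@eq_elementary (fun x => F i x * \prod_(i <- s | P i) F i x)).
  by apply: elementaryM => //; exact: eF.
by move=> x; rewrite big_cons Pi.
Qed.

Lemma elementaryX f n : elementary f -> elementary (fun x => f x ^+ n).
Proof.
move=> ef; elim: n => [|n IH].
  apply: (@eq_elementary (fun=> 1)); first exact: elementary_cst.
  by move=> x; rewrite expr0.
apply: (@eq_elementary (fun x => f x * f x ^+ n)); first exact: elementaryM.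
by move=> x; rewrite exprS.
Qed.

Lemma elementary_comp (h : R -> R) f : elementary h -> elementary f ->
  elementary (fun x => h (f x)).
Proof.
move=> eh ef; elim: eh => {h}.
- by move=> c; exact: elementary_cst.
- move=> h _; apply: (@eq_elementary (fun x => f x * h 1)).
    by apply: elementaryM => //; exact: elementary_cst.
  by move=> x; rewrite -[in LHS](mulr1 (f x)) [in LHS]linearZ.
- by move=> g h _ IH _ IH'; exact: (elementaryD IH IH').
- by move=> g h _ IH _ IH'; exact: (elementaryM IH IH').
- by move=> g g0 _ IH; apply: (elementaryV _ IH).
- by move=> n g _ IH; apply: (elementary_flat_exp _ IH).
Qed.

(** Leibniz rule. As the list has no repetition, the condition [j != i] removes exactly the factor
    that is differentiated. *)
Lemma derive_prod (I : eqType) (s : seq I) (F : I -> V -> R) x v : uniq s ->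
  (forall i, elementary (F i)) ->
  'D_v (fun y => \prod_(i <- s) F i y) x =
  \sum_(i <- s) 'D_v (F i) x * \prod_(j <- s | j != i) F j x.
Proof.
move=> + eF; elim: s => [_|i s IH /= /andP[is_ us]].
  rewrite big_nil (_ : (fun _ => _) = fun=> 1) ?derive_cst//.
  by apply/funext => y; rewrite big_nil.
have -> : (fun y => \prod_(k <- i :: s) F k y) =
    F i * (fun y => \prod_(k <- s) F k y).
  by apply/funext => y; rewrite big_cons fctE.
have ei : derivable (F i) x v by exact: derivable_elementary.
have es : elementary (fun y => \prod_(k <- s) F k y) by exact: elementary_prod.
rewrite deriveM//; last exact: derivable_elementary.
rewrite IH// /GRing.scale /= big_cons addrC; congr (_ + _).
  rewrite mulrC big_cons eqxx /=; congr (_ * _).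
  rewrite big_seq [RHS]big_seq_cond; apply: eq_bigl => j.
  have [js|//] := boolP (j \in s); rewrite ?andbF//=.
  by apply/esym/eqP => ji; move: is_; rewrite -ji js.
rewrite mulr_sumr !big_seq; apply: eq_bigr => j js.
rewrite big_cons ifT; last by apply/eqP => ij; move: is_; rewrite ij js.
by rewrite mulrCA.
Qed.

End Elementary.

Lemma elementary_id : elementary (@idfun R).
Proof. by apply: (@elementary_lin _ idfun) => x; exact: cvg_id. Qed.

Definition smooth_step (t : R) : R :=
  flat_exp 0 t * (flat_exp 0 t + flat_exp 0 (1 - t))^-1.

Let step_den t : 0 < flat_exp 0 t + flat_exp 0 (1 - t).
Proof.
have [t0|t0] := ltrP 0 t; first by rewrite ltr_wpDr ?flat_exp_ge0// flat_exp_gt0.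
by rewrite ltr_wpDl ?flat_exp_ge0// flat_exp_gt0// subr_gt0 (le_lt_trans t0).
Qed.

Lemma elementary_step : elementary smooth_step.
Proof.
have e0 := elementary_flat_exp 0 elementary_id.
have e1 := elementary_flat_exp 0 (elementaryB (elementary_cst _ 1) elementary_id).
apply: elementaryM => //; apply: elementaryV; last exact: elementaryD.
by move=> t; rewrite gt_eqF.
Qed.

Lemma smooth_step_ge0 t : 0 <= smooth_step t.
Proof. by rewrite mulr_ge0 ?flat_exp_ge0// invr_ge0 ltW. Qed.

Lemma smooth_step_le1 t : smooth_step t <= 1.
Proof. by rewrite ler_pdivrMr// mul1r lerDl flat_exp_ge0. Qed.

Lemma smooth_step0 t : t <= 0 -> smooth_step t = 0.
Proof. by move=> t0; rewrite /smooth_step flat_exp0// mul0r. Qed.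

Lemma smooth_step1 t : 1 <= t -> smooth_step t = 1.
Proof.
move=> t1; rewrite /smooth_step (@flat_exp0 0 (1 - t)) ?subr_le0// addr0 divff//.
by rewrite gt_eqF// flat_exp_gt0// (lt_le_trans ltr01).
Qed.

(** The argument [4 - t * t] is at least 3 on [-1, 1] and at most 0 off (-2, 2), which yields a
    plateau and a compact support while staying polynomial in [t], hence elementary. *)
Definition bump (t : R) : R := smooth_step (4 - t * t).

Lemma elementary_bump : elementary bump.
Proof.
apply: elementary_comp; first exact: elementary_step.
apply: elementaryB; first exact: elementary_cst.
by apply: elementaryM; exact: elementary_id.
Qed.

Lemma bump_ge0 t : 0 <= bump t. Proof. exact: smooth_step_ge0. Qed.
Lemma bump_le1 t : bump t <= 1. Proof. exact: smooth_step_le1. Qed.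

Lemma bump1 t : `|t| <= 1 -> bump t = 1.
Proof. by rewrite ler_norml => /andP[? ?]; apply: smooth_step1; nra. Qed.

Lemma bump0 t : 2 <= `|t| -> bump t = 0.
Proof. by rewrite ler_normr => /orP[] ?; apply: smooth_step0; nra. Qed.

End FlatExponential.

(** * Borel sets of the plane and of space *)

Section BorelProduct.
Context {R : realType}.
Local Notation leb := (@lebesgue_measure R).
Local Notation M2 := (measurableTypeR R * measurableTypeR R)%type.
Local Notation M3 := (M2 * measurableTypeR R)%type.

(** Applied to boxes with rational centre and radius, this puts the open sets of the plane and of
    space into the product sigma-algebras. *)
Lemma countable_cover_measurable d (X : measurableType d) (I : countType)
    (B : I -> set X) (U : set X) : (forall i, measurable (B i)) ->
  (forall x, U x -> exists2 i, B i x & B i `<=` U) -> measurable U.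
Proof.
move=> mB cov.
have -> : U = \bigcup_(n in [set n | exists2 i, unpickle n = Some i & B i `<=` U])
    (if @unpickle I n is Some i then B i else set0).
  apply/seteqP; split => x.
    move=> /cov[i Bix BiU]; exists (pickle i); last by rewrite pickleK.
    by exists i => //; exact: pickleK.
  by move=> [n [i -> BiU]]; exact: BiU.
by apply: bigcup_measurable => n [i -> _].
Qed.

Lemma ball_rat (x r : R) : 0 < r -> exists q : rat, ball x r (ratr q).
Proof.
move=> r0; have [q] := @rat_in_itvoo R (x - r) (x + r) ltac:(lra).
by rewrite in_itv /= => h; exists q; rewrite -ball_normE /ball_/=;
  rewrite ltr_distlC.
Qed.

(** The doubled radius leaves room for moving the centre to a rational point nearby. *)
Lemma open_rat_radius (V : pseudoMetricType R) (U : set V) x : open U -> U x ->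
  exists r : rat, 0 < (ratr r : R) /\ ball x (ratr r + ratr r : R) `<=` U.
Proof.
rewrite openE => oU /oU /nbhs_ballP[e /= e0 eU].
have e20 : 0 < e / 2 by rewrite divr_gt0.
have [q] := @rat_in_itvoo R 0 (e / 2) e20.
rewrite in_itv /= => /andP[q0 qe]; exists q; split => //.
by move=> y xy; apply: eU; apply: le_ball xy; lra.
Qed.

Lemma open_measurable2 (U : set (R * R)) : open U -> measurable (U : set M2).
Proof.
move=> oU; apply: (@countable_cover_measurable _ _ (rat * rat * rat)%type
  (fun q => ball (ratr q.1.1 : R) (ratr q.2 : R) `*` ball (ratr q.1.2 : R) (ratr q.2 : R))).
  by move=> q; apply: measurableX; rewrite ball_itv; exact: measurable_itv.
move=> [x y] /(open_rat_radius oU)[r [r0 rU]].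
have [a xa] := ball_rat x r0; have [b yb] := ball_rat y r0.
exists (a, b, r); first by split; exact: ball_sym.
move=> [x' y'] [/= ax' by']; apply: rU.
by split => /=; [exact: ball_triangle xa ax'|exact: ball_triangle yb by'].
Qed.

Lemma open_measurable3 (U : set (E3 R)) : open U -> measurable (U : set M3).
Proof.
move=> oU; apply: (@countable_cover_measurable _ _ (rat * rat * rat * rat)%type
  (fun q => ball (ratr q.1.1.1 : R) (ratr q.2 : R) `*`
    ball (ratr q.1.1.2 : R) (ratr q.2 : R) `*` ball (ratr q.1.2 : R) (ratr q.2 : R))).
  by move=> q; do 2?apply: measurableX; rewrite ball_itv; exact: measurable_itv.
move=> [[x y] z] /(open_rat_radius oU)[r [r0 rU]].
have [a xa] := ball_rat x r0; have [b yb] := ball_rat y r0.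
have [c zc] := ball_rat z r0.
exists (a, b, c, r); first by do ![split => /=]; exact: ball_sym.
move=> [[x' y'] z'] [[/= ax' by'] cz']; apply: rU.
by split => /=; [split => /=; [exact: ball_triangle xa ax'|exact: ball_triangle yb by']|exact: ball_triangle zc cz'].
Qed.

Lemma compact_measurable2 (K : set (R * R)) : compact K -> measurable (K : set M2).
Proof.
move=> /compact_closed => /(_ (@norm_hausdorff _ _)) /closed_openC /open_measurable2.
by move=> /measurableC; rewrite setCK.
Qed.

Lemma compact_measurable3 (K : set (E3 R)) : compact K -> measurable (K : set M3).
Proof.
move=> /compact_closed => /(_ (@norm_hausdorff _ _)) /closed_openC /open_measurable3.
by move=> /measurableC; rewrite setCK.
Qed.

Lemma open_preimage_measurable_fun d (X : measurableType d) (D : set X) (f : X -> R) :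
  measurable D ->
  (forall U : set R, open U -> exists2 V, measurable V & D `&` f @^-1` U = D `&` V) ->
  measurable_fun D f.
Proof.
move=> mD H; apply: (measurability _ (RGenOpens.measurableE R)).
move=> _ [_ [a [b ->] <-]].
have [V mV ->] := H _ (@interval_open R (BRight a) (BLeft b) isT isT).
exact: measurableI.
Qed.

Lemma within_continuous_measurable2 (D : set (R * R)) (f : R * R -> R) :
  measurable (D : set M2) -> {within D, continuous f} ->
  measurable_fun (D : set M2) f.
Proof.
move=> mD /continuousP cf; apply: open_preimage_measurable_fun => // U oU.
have /open_subspaceP[V oV VD] := cf _ oU.
exists V; first exact: open_measurable2.
by rewrite setIC -VD setIC.
Qed.

Lemma within_continuous_measurable3 (D : set (E3 R)) (f : E3 R -> R) :
  measurable (D : set M3) -> {within D, continuous f} ->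
  measurable_fun (D : set M3) f.
Proof.
move=> mD /continuousP cf; apply: open_preimage_measurable_fun => // U oU.
have /open_subspaceP[V oV VD] := cf _ oU.
exists V; first exact: open_measurable3.
by rewrite setIC -VD setIC.
Qed.

Lemma prod_normE (U V : normedModType R) (x : U * V) :
  `|x| = Num.max `|x.1| `|x.2|.
Proof. by []. Qed.

Lemma compact_norm_bound (V : normedModType R) (K : set V) : compact K ->
  exists2 N : R, 0 < N & forall x, K x -> `|x| <= N.
Proof.
move=> /compact_bounded[N [_ HN]]; exists (`|N| + 1); first by rewrite ltr_wpDl.
by move=> x Kx; apply: HN => //; rewrite ltr_pwDr// ler_norm.
Qed.

Definition cube2 (N : R) : set M2 := `[- N, N]%classic `*` `[- N, N]%classic.
Definition cube3 (N : R) : set M3 := cube2 N `*` `[- N, N]%classic.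

Lemma measurable_cube2 N : measurable (cube2 N).
Proof. by apply: measurableX; exact: measurable_itv. Qed.

Lemma measurable_cube3 N : measurable (cube3 N).
Proof. by apply: measurableX; [exact: measurable_cube2|exact: measurable_itv]. Qed.

Let leb_itv_lty (N : R) : (leb `[(- N)%R, N]%classic < +oo)%E.
Proof.
by rewrite lebesgue_measure_itv/=; case: ifPn => // _; rewrite -EFinD ltry.
Qed.

Lemma leb2_cube (N : R) : (leb2 (cube2 N) < +oo)%E.
Proof.
rewrite [ltLHS](@product_measure1E _ _ _ _ _ leb leb) ?measurable_itv//.
apply: lte_mul_pinfty; first exact: measure_ge0.
- by rewrite ge0_fin_numE ?measure_ge0//; exact: leb_itv_lty.
- exact: leb_itv_lty.
Qed.

Lemma leb3_cube (N : R) : (leb3 (cube3 N) < +oo)%E.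
Proof.
rewrite [ltLHS](@product_measure1E _ _ _ _ _ leb2sf leb) ?measurable_itv//; last exact: measurable_cube2.
apply: lte_mul_pinfty; first exact: measure_ge0.
- by rewrite ge0_fin_numE ?measure_ge0//; exact: leb2_cube.
- exact: leb_itv_lty.
Qed.

Lemma norm_cube2 (N : R) (x : R * R) : `|x| <= N -> cube2 N x.
Proof.
move=> xN; split => /=; rewrite in_itv /= -ler_norml; apply: le_trans xN;
  by rewrite prod_normE le_max lexx ?orbT.
Qed.

Lemma norm_cube3 (N : R) (x : E3 R) : `|x| <= N -> cube3 N x.
Proof.
move=> xN; split => /=; last first.
  by rewrite in_itv /= -ler_norml; apply: le_trans xN; rewrite prod_normE le_max lexx orbT.
by apply: norm_cube2; apply: le_trans xN; rewrite [leRHS]prod_normE le_max lexx.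
Qed.

Lemma leb2_compact_lty (K : set (R * R)) : compact K -> (leb2 (K : set M2) < +oo)%E.
Proof.
move=> cK; have [N N0 KN] := compact_norm_bound cK.
apply: le_lt_trans (leb2_cube N); apply: le_measure; rewrite ?inE.
- exact: compact_measurable2.
- exact: measurable_cube2.
- by move=> x Kx; apply: norm_cube2; exact: KN.
Qed.

Lemma leb3_compact_lty (K : set (E3 R)) : compact K -> (leb3 (K : set M3) < +oo)%E.
Proof.
move=> cK; have [N N0 KN] := compact_norm_bound cK.
apply: le_lt_trans (leb3_cube N); apply: le_measure; rewrite ?inE.
- exact: compact_measurable3.
- exact: measurable_cube3.
- by move=> x Kx; apply: norm_cube3; exact: KN.
Qed.

End BorelProduct.

(** * Cutting off at the boundary *)

Section Cut.
Context {R : realType}.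

(** The zero map serves as differential, since the remainder is identically zero near the point. *)
Lemma near0_differentiable (V W : normedModType R) (d : V -> W) x :
  (\near x, d x = 0) -> differentiable d x.
Proof.
move=> d0; have dx0 : d x = 0 by exact: nbhs_singleton d0.
have E : d \o shift x = cst (d x) + (\0 : V -> W) +o_ (0 : V) id.
  apply/eqaddoP => e e0 /=; near=> h.
  have -> : (d \o shift x - (cst (d x) + (\0 : V -> W))) h = d (h + x).
    by rewrite !fctE dx0 addr0 subr0.
  have -> : d (h + x) = 0.
    by near: h; move: d0; rewrite (near_shift (0 : V)) subr0.
  by rewrite normr0 mulr_ge0// ltW.
have cst0 : continuous (\0 : V -> W) by move=> y; exact: cvg_cst.
have dd := @diff_unique _ _ _ d (\0 : {linear V -> W}) x cst0 E.
by apply/diff_locallyP; rewrite dd.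
Unshelve. all: by end_near. Qed.

Lemma near_eq_differentiable (V W : normedModType R) (f g : V -> W) x :
  {near x, f =1 g} -> differentiable f x -> differentiable g x.
Proof.
move=> fg df; have -> : g = f + (g - f) by rewrite addrC subrK.
apply: differentiableD => //; apply: near0_differentiable.
by apply: filterS fg => y; rewrite !fctE => ->; rewrite subrr.
Qed.

(** Near every point the truncation [e \_ U] thus coincides either with [e] or with zero, and so
    inherits smoothness from [e]. *)
Lemma closed_boundary_nbhs (U : set (E3 R)) (e : E3 R -> R) (x : E3 R) :
  closed U -> (forall y, (U `\` U°) y -> \near y, e y = 0) ->
  [\/ U° x, (\near x, e x = 0) | (\near x, (~` U) x)].
Proof.
move=> cU e0; have [Ux|Ux] := pselect (U x).
  have [oUx|oUx] := pselect (U° x); first exact: Or31.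
  by apply: Or32; apply: e0.
by apply: Or33; apply: open_nbhs_nbhs; split => //; exact: closed_openC.
Qed.

Section CutSmooth.
Variables (U : set (E3 R)) (cU : closed U).

Let cut_near (e : E3 R -> R) x : (forall y, (U `\` U°) y -> \near y, e y = 0) ->
  {near x, e =1 e \_ U} \/ (\near x, (e \_ U) x = 0) /\
    (forall v, elementary e -> ('D_v e \_ U) x = 0).
Proof.
move=> e0; have [oUx|ex|nUx] := closed_boundary_nbhs x cU e0.
- left; apply: filterS oUx => y Uy; rewrite patchE ifT//; exact/mem_set.
- right; split; first by apply: filterS ex => y ey; rewrite patchE ey if_same.
  move=> v _; rewrite patchE; case: ifP => // _.
  rewrite (near_eq_derive v (g := fun=> 0)) ?derive_cst//.
- right; split; first by apply: filterS nUx => y Uy; rewrite patchE ifF//; exact/memNset.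
  by move=> v _; rewrite patchE ifF//; apply/memNset; exact: nbhs_singleton nUx.
Qed.

Lemma differentiable_cut (e : E3 R -> R) x :
  (forall y, (U `\` U°) y -> \near y, e y = 0) -> elementary e ->
  differentiable (e \_ U) x.
Proof.
move=> e0 ee; have [ex|[ex _]] := cut_near x e0.
  by apply: near_eq_differentiable ex _; exact: differentiable_elementary.
exact: near0_differentiable.
Qed.

Lemma derive_cut (e : E3 R -> R) x v :
  (forall y, (U `\` U°) y -> \near y, e y = 0) -> elementary e ->
  'D_v (e \_ U) x = ((fun y => 'D_v e y) \_ U) x.
Proof.
move=> e0 ee; have [ex|[ex ->//]] := cut_near x e0; last first.
  by rewrite (near_eq_derive v (g := fun=> 0)) ?derive_cst//.
have [Ux|Ux] := pselect (U x).
  rewrite patchE ifT; last exact/mem_set.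
  by apply: near_eq_derive; apply: filterS ex => y ->.
rewrite patchE ifF; last exact/memNset.
rewrite (near_eq_derive v (g := fun=> 0)) ?derive_cst//.
apply: (@filterS _ _ _ (~` U)); last first.
  by apply: open_nbhs_nbhs; split => //; exact: closed_openC.
by move=> y Uy; rewrite patchE ifF//; exact/memNset.
Qed.

Lemma derive_vanishes (e : E3 R -> R) (y v : E3 R) :
  (\near y, e y = 0) -> \near y, 'D_v e y = 0.
Proof.
move=> ey; have := near_join ey; apply: filterS => z ez.
by rewrite (near_eq_derive v (g := fun=> 0)) ?derive_cst.
Qed.

Lemma smooth_cut (e : E3 R -> R) :
  (forall y, (U `\` U°) y -> \near y, e y = 0) -> elementary e ->
  smooth (e \_ U).
Proof.
move=> e0 ee vs x.
(* The induction carries a stronger invariant: each iterated derivative is again the truncation of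
   an elementary function that vanishes near the boundary. *)
suff [e' [-> ee' e0']] : exists e', [/\ iter_derive vs (e \_ U) = e' \_ U,
    elementary e' & forall y, (U `\` U°) y -> \near y, e' y = 0].
  exact: differentiable_cut.
elim: vs => [|v vs [e' [E ee' e0']]]; first by exists e.
exists (fun x => 'D_v e' x); split.
- apply/funext => y; rewrite -derive_cut// -E.
  by [].
- exact: elementary_derive.
- by move=> y /e0'; exact: derive_vanishes.
Qed.

Lemma support_cut (e : E3 R -> R) :
  (forall y, (U `\` U°) y -> \near y, e y = 0) ->
  closure [set x | (e \_ U) x != 0] `<=` U°.
Proof.
move=> e0 x cx; have [//|ex|nUx] := closed_boundary_nbhs x cU e0; exfalso.
- have [y [/= /eqP + ey]] := cx _ ex.
  by apply; rewrite patchE ey if_same.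
- have [y [/= /eqP + Uy]] := cx _ nUx.
  by apply; rewrite patchE ifF//; exact/memNset.
Qed.

End CutSmooth.

Lemma test_fun_cut (T : polyhedron R) (e : E3 R -> R) :
  (forall y, (T `\` T°) y -> \near y, e y = 0) -> elementary e ->
  test_fun T (e \_ T).
Proof.
have cT : closed T by apply: compact_closed; [exact: norm_hausdorff|exact: ph_compact].
move=> e0 ee; split.
- exact: smooth_cut.
- apply: (subclosed_compact _ (@ph_compact _ T)); first exact: closed_closure.
  by apply: subset_trans (support_cut cT e0) _; exact: interior_subset.
- exact: support_cut.
Qed.

End Cut.

(** * Faces *)

Section Frame.
Context {R : realType}.
Implicit Types (a b x y : E3 R) (F : face R) (z : R * R).

Lemma continuous_E3 : [/\ continuous (fun x : E3 R => x.1.1),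
  continuous (fun x : E3 R => x.1.2) & continuous (fun x : E3 R => x.2)].
Proof.
split => x.
- apply: (@continuous_comp _ _ _ (fst : E3 R -> R * R) fst); exact: cvg_fst.
- apply: (@continuous_comp _ _ _ (fst : E3 R -> R * R) snd).
    exact: cvg_fst.
  exact: cvg_snd.
- exact: cvg_snd.
Qed.

Definition dotr a x : R := dot x a.

Lemma dotr_linear a : linear (dotr a).
Proof. by move=> k x y; rewrite /dotr /dot /= /GRing.scale /=; ring. Qed.

HB.instance Definition _ a := GRing.isLinear.Build R (E3 R) R _ (dotr a) (dotr_linear a).

Lemma dotr_continuous a : continuous (dotr a).
Proof.
have [c1 c2 c3] := continuous_E3.
by move=> x; apply: cvgD; [apply: cvgD|]; apply: cvgM; try exact: cvg_cst;
  [exact: c1|exact: c2|exact: c3].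
Qed.

Lemma elementary_dot a b : elementary (fun x => dot (x - b) a).
Proof.
apply: (@eq_elementary _ _ (fun x => dotr a x - dot b a)).
  apply: elementaryB; last exact: elementary_cst.
  apply: elementary_lin; exact: dotr_continuous.
by move=> x; rewrite /dotr /dot /=; ring.
Qed.

Lemma derive_dot a b x v : 'D_v (fun x => dot (x - b) a) x = dot v a.
Proof.
rewrite (_ : (fun x => dot (x - b) a) = dotr a - cst (dot b a)); last first.
  by apply/funext => y; rewrite !fctE /dotr /dot /=; ring.
rewrite deriveB ?derive_cst ?subr0.
- by rewrite derive_lin//; exact: dotr_continuous.
- by apply: derivable_elementary; apply: elementary_lin; exact: dotr_continuous.
- exact: derivable_cst.
Qed.

Lemma dotC a b : dot a b = dot b a.
Proof. by rewrite /dot; ring. Qed.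

Lemma dot_crossl a b : dot a (cross a b) = 0.
Proof. by rewrite /dot /=; ring. Qed.

Lemma dot_crossr a b : dot b (cross a b) = 0.
Proof. by rewrite /dot /=; ring. Qed.

Lemma dot_cross_cross a b :
  dot (cross a b) (cross a b) = dot a a * dot b b - dot a b ^+ 2.
Proof. by rewrite /dot /=; ring. Qed.

Lemma cross_crossE a b x : cross a (cross b x) = dot a x *: b - dot a b *: x.
Proof. by apply: E3_eq; rewrite /dot /= /GRing.scale /=; ring. Qed.

Lemma outward_unit F : dot (outward F) (outward F) = 1.
Proof. by rewrite dot_cross_cross fu_unit fv_unit fuv_orth; ring. Qed.

Lemma dotDl a b x : dot (a + b) x = dot a x + dot b x.
Proof. by rewrite /dot /=; ring. Qed.

Lemma dotZl k a x : dot (k *: a) x = k * dot a x.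
Proof. by rewrite /dot /= /GRing.scale /=; ring. Qed.

Lemma dotBl a b x : dot (a - b) x = dot a x - dot b x.
Proof. by rewrite /dot /=; ring. Qed.

Lemma dot_eq0 a : dot a a = 0 -> a = 0.
Proof.
rewrite /dot => h.
have h1 : a.1.1 ^+ 2 = 0 by have := sqr_ge0 a.1.1; have := sqr_ge0 a.1.2; have := sqr_ge0 a.2; rewrite !expr2; lra.
have h2 : a.1.2 ^+ 2 = 0 by have := sqr_ge0 a.1.1; have := sqr_ge0 a.1.2; have := sqr_ge0 a.2; rewrite !expr2; lra.
have h3 : a.2 ^+ 2 = 0 by have := sqr_ge0 a.1.1; have := sqr_ge0 a.1.2; have := sqr_ge0 a.2; rewrite !expr2; lra.
by apply: E3_eq; apply/eqP; rewrite -sqrf_eq0; apply/eqP.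
Qed.

(* Lagrange's identity: a vector orthogonal to the frame is zero. *)
Lemma frame_complete F a : dot a (fu F) = 0 -> dot a (fv F) = 0 ->
  dot a (outward F) = 0 -> a = 0.
Proof.
move=> au av an; apply: dot_eq0.
have := dot_cross_cross a (outward F).
rewrite outward_unit an expr0n subr0 mulr1 => <-.
rewrite /outward cross_crossE au av !scale0r subr0 /dot /=; ring.
Qed.

Lemma frame_decomp F a :
  a = dot a (fu F) *: fu F + dot a (fv F) *: fv F + dot a (outward F) *: outward F.
Proof.
apply/eqP; rewrite -subr_eq0; apply/eqP; apply: (@frame_complete F).
- rewrite dotBl !dotDl !dotZl fu_unit (dotC (fv F)) fuv_orth (dotC (outward F)) dot_crossl; ring.
- rewrite dotBl !dotDl !dotZl fv_unit fuv_orth (dotC (outward F)) dot_crossr; ring.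
- rewrite dotBl !dotDl !dotZl outward_unit dot_crossl dot_crossr; ring.
Qed.

(** In the orthonormal frame of the face both tangential coefficients of [nu] vanish. The condition
    [s * s = 1] says that [s] is a sign. *)
Lemma unit_normalP F (nu : E3 R) : unit_normal F nu ->
  exists2 s : R, s * s = 1 & nu = s *: outward F.
Proof.
case=> n1 nu0 nv0; have nE := frame_decomp F nu.
rewrite nu0 nv0 !scale0r !add0r in nE.
move: nE; set s := dot nu (outward F) => nE; exists s => //.
by move: n1; rewrite nE dotZl dotC dotZl outward_unit mulr1.
Qed.

(** Positive on the outer side: just below the relative interior of a face, [T] has negative
    heights. *)
Definition height F x : R := dot (x - fo F) (outward F).
Definition foot F x : R * R := (dot (x - fo F) (fu F), dot (x - fo F) (fv F)).
Definition lift_face F z (s : R) : E3 R :=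
  fo F + z.1 *: fu F + z.2 *: fv F + s *: outward F.

Lemma lift_faceE F z s : lift_face F z s = chart F z + s *: outward F.
Proof. by []. Qed.

Lemma lift_face_sub F z s :
  lift_face F z s - fo F = z.1 *: fu F + z.2 *: fv F + s *: outward F.
Proof. by apply: E3_eq; rewrite /= /GRing.scale /=; ring. Qed.

Lemma footK F x : lift_face F (foot F x) (height F x) = x.
Proof.
apply/eqP; rewrite -(inj_eq (addIr (- fo F))); apply/eqP.
by rewrite lift_face_sub [RHS](frame_decomp F).
Qed.

Lemma height_lift F z s : height F (lift_face F z s) = s.
Proof.
rewrite /height lift_face_sub !dotDl !dotZl.
rewrite outward_unit dot_crossl dot_crossr; ring.
Qed.

Lemma foot_lift F z s : foot F (lift_face F z s) = z.
Proof.
rewrite /foot lift_face_sub !dotDl !dotZl.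
rewrite fu_unit fv_unit (dotC (fv F) (fu F)) fuv_orth (dotC (outward F)) dot_crossl.
rewrite (dotC (outward F)) dot_crossr.
by case: z => z1 z2 /=; congr pair; ring.
Qed.

Lemma height_chart F z : height F (chart F z) = 0.
Proof. by have := height_lift F z 0; rewrite lift_faceE scale0r addr0. Qed.

Lemma foot_chart F z : foot F (chart F z) = z.
Proof. by have := foot_lift F z 0; rewrite lift_faceE scale0r addr0. Qed.

Lemma chart_foot F x : height F x = 0 -> chart F (foot F x) = x.
Proof. by move=> h; have := footK F x; rewrite h lift_faceE scale0r addr0. Qed.

Lemma continuous_height F : continuous (height F).
Proof. exact: (continuous_elementary (elementary_dot (outward F) (fo F))). Qed.

Lemma continuous_foot F : continuous (foot F).
Proof.
move=> x.
have h1 := continuous_elementary (elementary_dot (fu F) (fo F)) (x := x).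
have h2 := continuous_elementary (elementary_dot (fv F) (fo F)) (x := x).
exact: (cvg_pair h1 h2).
Qed.

(** The frame is orthonormal and positively oriented. The factor [e] will be the thickness of the
    layer, and hence the Jacobian of the stretching. *)
Lemma det3_frame F (e : R) : det3 (fu F) (fv F) (e *: outward F) = e.
Proof.
have := outward_unit F; rewrite det3E /outward /dot /= /GRing.scale /= => h.
by rewrite -[RHS]mulr1 -h; ring.
Qed.

Lemma continuous_chart F : continuous (chart F).
Proof.
move=> z.
have h1 : (z'.1 *: fu F) @[z' --> z] --> z.1 *: fu F.
  by apply: cvgZr_tmp; exact: cvg_fst.
have h2 : (z'.2 *: fv F) @[z' --> z] --> z.2 *: fv F.
  by apply: cvgZr_tmp; exact: cvg_snd.
exact: (cvgD (cvgD (cvg_cst (fo F)) h1) h2).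
Qed.

End Frame.

(** * Layers around a face *)

Section Layer.
Context {R : realType}.

(** Finitely many small bumps centred in [K] have a sum that is positive on [K], by compactness, and
    a step function levels this sum to 1 near [K]. The last clause makes composition with the foot
    point elementary. *)
Lemma smooth_urysohn (K : set (R * R)) (d : R) : compact K -> K !=set0 -> 0 < d ->
  exists psi : R * R -> R, [/\ forall z, 0 <= psi z <= 1,
    (forall k, K k -> \near k, psi k = 1),
    (forall z, psi z != 0 -> exists2 k, K k & `|z - k| < d) &
    forall (V : normedModType R) (a b : V -> R), elementary a -> elementary b ->
      elementary (fun x => psi (a x, b x))].
Proof.
move=> cK K0 d0.
(* Positive exactly on the Euclidean disc of radius [d] about [c], which lies in the ball of radius
   [d] for the maximum norm. *)
pose r (c z : R * R) := d ^+ 2 - (z.1 - c.1) ^+ 2 - (z.2 - c.2) ^+ 2.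
pose b c z := flat_exp 0 (r c z).
have eb c (V : normedModType R) (f g : V -> R) : elementary f -> elementary g ->
    elementary (fun x => b c (f x, g x)).
  move=> ef eg; apply: elementary_flat_exp; apply: elementaryB.
    apply: elementaryB; first exact: elementary_cst.
    by apply: elementaryX; apply: elementaryB => //; exact: elementary_cst.
  by apply: elementaryX; apply: elementaryB => //; exact: elementary_cst.
have e1 : elementary (fst : R * R -> R).
  by apply: (@elementary_lin _ _ fst) => z; exact: cvg_fst.
have e2 : elementary (snd : R * R -> R).
  by apply: (@elementary_lin _ _ snd) => z; exact: cvg_snd.
have cb c : continuous (b c).
  rewrite (_ : b c = fun z => b c (z.1, z.2)); last by apply/funext => -[].
  exact: continuous_elementary (eb c _ _ _ e1 e2).
have b0 c z : 0 <= b c z by exact: flat_exp_ge0.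
have bd c z : b c z != 0 -> `|z - c| < d.
  move=> bz; have r0 : 0 < r c z.
    by rewrite ltNge; apply: contra bz => ?; rewrite /b flat_exp0.
  rewrite prod_normE gt_max /=; move: r0; rewrite /r => r0.
  have h1 := sqr_ge0 (z.1 - c.1); have h2 := sqr_ge0 (z.2 - c.2).
  apply/andP; split; rewrite -ltr_sqr ?nnegrE ?normr_ge0 ?ltW// real_normK ?num_real//; lra.
pose P : ptopologicalType := HB.pack (R * R)%type.
have : @cover_compact (R * R)%type K by have := cK; rewrite (@compact_cover P).
move=> /(_ _ K (fun c => [set z | 0 < b c z])).
case=> [c _|z Kz|D DK cov].
- apply: (@open_comp _ _ (b c) [set y | 0 < y]) => [z _|]; [exact: (cb c z)|exact: open_gt].
- exists z => //=; apply: flat_exp_gt0; rewrite /r !subrr expr0n /= !subr0.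
  by rewrite exprn_gt0.
pose B z := \sum_(c <- finmap.enum_fset D) b c z.
have eB (V : normedModType R) (f g : V -> R) : elementary f -> elementary g ->
    elementary (fun x => B (f x, g x)).
  by move=> ef eg; apply: elementary_sum => c _; exact: eb.
have cB : continuous B.
  rewrite (_ : B = fun z => B (z.1, z.2)); last by apply/funext => -[].
  exact: continuous_elementary (eB _ _ _ e1 e2).
have BK z : K z -> 0 < B z.
  move=> /cov[c /= cD bz]; rewrite /B (big_rem c)//=.
  by rewrite ltr_wpDr// sumr_ge0.
have [k0 + k0m] := compact_EVT_min K0 cK (continuous_subspaceT cB).
rewrite inE => Kk0; have m0 := BK _ Kk0; set m := B k0 in m0.
(* With [m] the minimum of [B] on [K], the argument is at least 1 wherever [m / 2 < B z], which is a
   neighbourhood of each point of [K]. *)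
exists (fun z => smooth_step (2 / m * B z)); split.
- by move=> z; rewrite smooth_step_ge0 smooth_step_le1.
- move=> k Kk; have mk : m / 2 < B k.
    by rewrite (lt_le_trans _ (k0m _ (mem_set Kk)))// -/m; lra.
  have : \near k, m / 2 < B k by exact: (@cvgr_gt _ _ _ _ B (B k) (cB k)).
  apply: filterS => z mz; apply: smooth_step1.
  by rewrite mulrAC ler_pdivlMr// mul1r; lra.
- move=> z sz; have : B z != 0.
    by apply: contra sz => /eqP ->; rewrite mulr0 smooth_step0.
  rewrite /B => /eqP Bz.
  have [c cD bc] : exists2 c, c \in finmap.enum_fset D & b c z != 0.
    apply: contrapT => H; apply: Bz; rewrite big_seq big1// => c cD.
    by apply/eqP; apply: contrapT => /negP bc; apply: H; exists c.
  by exists c; [exact/set_mem/DK|exact: bd].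
- move=> V f g ef eg; apply: elementary_comp; first exact: elementary_step.
  by apply: elementaryM; [exact: elementary_cst|exact: eB].
Qed.

Lemma continuous_grad (f : E3 R -> R) : elementary f -> continuous (grad f).
Proof.
move=> ef x.
have h v := continuous_elementary (elementary_derive v ef) (x := x).
exact: (cvg_pair (cvg_pair (h (1, 0, 0)) (h (0, 1, 0))) (h (0, 0, 1))).
Qed.

Variables (F : face R) (T : set (E3 R)) (cT : compact T).

(* A family of functions of the foot point, tending to the indicator of the
   face, whose gradients are small compared to the thickness eps of the layer. *)
Definition layer (eps : R^nat) (E : nat -> E3 R -> R) := forall m,
  [/\ 0 < eps m <= m.+1%:R^-1, elementary (E m), forall x, 0 <= E m x <= 1,
     (forall y, face_set F y -> \near y, E m y = 1) &
     [/\ (forall x, E m x != 0 -> exists2 k, fdom F k & `|foot F x - k| < m.+1%:R^-1),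
        (forall x, T x -> `|eps m *: grad (E m) x| <= m.+1%:R^-1) &
        forall x y, foot F x = foot F y -> E m x = E m y]].

Lemma layer_exists : exists eps E, layer eps E.
Proof.
have /choice[e He] : forall m : nat, exists p : R * (E3 R -> R),
    [/\ 0 < p.1 <= m.+1%:R^-1, elementary p.2, forall x, 0 <= p.2 x <= 1,
     (forall y, face_set F y -> \near y, p.2 y = 1) &
     [/\ (forall x, p.2 x != 0 -> exists2 k, fdom F k & `|foot F x - k| < m.+1%:R^-1),
        (forall x, T x -> `|p.1 *: grad p.2 x| <= m.+1%:R^-1) &
        forall x y, foot F x = foot F y -> p.2 x = p.2 y]].
  move=> m; have m0 : (0 : R) < m.+1%:R^-1 by rewrite invr_gt0 ltr0n.
  have [psi [p01 p1 pd pe]] := smooth_urysohn (@fdom_compact _ F) (@fdom_neq0 _ F) m0.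
  pose E x := psi (foot F x).
  have eE : elementary E.
    by apply: pe; exact: elementary_dot.
  have cgE : compact (grad E @` T).
    by apply: continuous_compact => //; exact/continuous_subspaceT/continuous_grad.
  have [N N0 HN] := compact_norm_bound cgE.
  (* The thickness is chosen last: [N] bounds the gradient of [E] on the compact [T]. The summand 1
     also keeps the thickness itself below [m.+1%:R^-1]. *)
  exists (m.+1%:R^-1 / (1 + N), E); split => //=.
  - rewrite divr_gt0 ?addr_gt0//= ler_pdivrMr ?addr_gt0//.
    by apply: ler_peMr; rewrite ?lerDl ltW.
  - by move=> x; exact: p01.
  - move=> _ [z Kz <-]; have := p1 _ Kz; rewrite -{1}(foot_chart F z).
    exact: continuous_foot.
  - split => [x|x|x y]; [by move=> /pd| |by rewrite /E => ->].
    move=> Tx; rewrite normrZ ger0_norm; last by rewrite divr_ge0 ?addr_ge0 ?ltW.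
    rewrite [leLHS]mulrAC ler_pdivrMr ?addr_gt0// ler_pM2l//.
    by apply: le_trans (HN _ _) _; [exists x|rewrite lerDr].
exists (fun m => (e m).1), (fun m => (e m).2); exact: He.
Qed.

Variables (eps : R^nat) (E : nat -> E3 R -> R).
Hypothesis EL : layer eps E.

Definition eta m x : R := 1 - bump (height F x / eps m) * E m x.

Lemma eps_gt0 m : 0 < eps m.
Proof. by have [/andP[]] := EL m. Qed.

Lemma eps_cvg0 : eps @ \oo --> (0 : R).
Proof.
apply: (@squeeze_cvgr _ _ _ _ (fun=> 0) (fun m => m.+1%:R^-1)).
- by apply: nearW => m; have [/andP[e0 ->]] := EL m; rewrite ltW.
- exact: cvg_cst.
- exact: cvg_harmonic.
Qed.

Lemma elementary_height : elementary (height F).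
Proof. exact: elementary_dot. Qed.

Lemma elementary_bump_height m : elementary (fun x => bump (height F x / eps m)).
Proof.
apply: elementary_comp; first exact: elementary_bump.
by apply: elementaryM; [exact: elementary_height|exact: elementary_cst].
Qed.

Lemma elementary_eta m : elementary (eta m).
Proof.
have [_ eE _ _ _] := EL m.
apply: elementaryB; first exact: elementary_cst.
by apply: elementaryM => //; exact: elementary_bump_height.
Qed.

Lemma eta01 m x : 0 <= eta m x <= 1.
Proof.
have [_ _ /(_ x)/andP[E0 E1] _ _] := EL m.
have b0 := bump_ge0 (height F x / eps m); have b1 := bump_le1 (height F x / eps m).
rewrite /eta subr_ge0 lerBlDr lerDl mulr_ge0// andbT.
by apply: le_trans (ler_pM _ _ b1 E1) _; rewrite ?mulr1.
Qed.

Lemma eta_near0 m y : face_set F y -> \near y, eta m y = 0.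
Proof.
move=> Fy; have [_ _ _ /(_ _ Fy) E1 _] := EL m.
have h0 : height F y = 0 by case: Fy => z _ <-; exact: height_chart.
have : \near y, `|height F y| < eps m.
  have /cvgr_norm_lt : height F x @[x --> y] --> height F y by exact: continuous_height.
  by apply; rewrite h0 normr0 eps_gt0.
apply: filterS2 E1 => x E1 hx; rewrite /eta E1 mulr1 bump1 ?subrr//.
by rewrite normrM normfV (gtr0_norm (eps_gt0 m)) ler_pdivrMr ?eps_gt0// mul1r ltW.
Qed.

(** Off the plane of the face, the height divided by [eps m] leaves the support of [bump]; in the
    plane but off the face, the foot point has a positive distance to [fdom F] and [E m] vanishes. A
    moving point [u m] is allowed because the cutoffs of the other faces are evaluated at stretched
    points. *)
Lemma eta_eventually1 x (u : nat -> E3 R) : ~ face_set F x ->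
  u @ \oo --> x -> \forall m \near \oo, eta m (u m) = 1.
Proof.
move=> nFx ux; have [h0|h0] := eqVneq (height F x) 0; last first.
  have uh : height F (u m) @[m --> \oo] --> height F x.
    by apply: (cvg_comp _ _ ux); exact: continuous_height.
  have hh : 0 < `|height F x| / 2 by rewrite divr_gt0// normr_gt0.
  have h1 : \forall m \near \oo, `|height F x| / 2 < `|height F (u m)|.
    by apply: cvgr_norm_gt uh _ _; move: hh; lra.
  (* With the preceding bound, the height of [u m] exceeds twice [eps m], the threshold of
     [bump0]. *)
  have h2 : \forall m \near \oo, eps m < `|height F x| / 2 / 2.
    by apply: (cvgr_lt _ eps_cvg0); rewrite divr_gt0.
  near=> m; rewrite /eta bump0 ?mul0r ?subr0//.
  rewrite normrM normfV (gtr0_norm (eps_gt0 m)) ler_pdivlMr ?eps_gt0//.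
  have a1 : `|height F x| / 2 < `|height F (u m)| by near: m.
  have a2 : eps m < `|height F x| / 2 / 2 by near: m.
  lra.
have nK : ~ fdom F (foot F x).
  by move=> Kx; apply: nFx; exists (foot F x) => //; exact: chart_foot.
have cK : closed (fdom F) by apply: compact_closed; [exact: norm_hausdorff|exact: fdom_compact].
have : nbhs (foot F x) (~` fdom F).
  by apply: open_nbhs_nbhs; split => //; exact: closed_openC.
move=> /nbhs_ballP[r /= r0 rK].
have uf : foot F (u m) @[m --> \oo] --> foot F x.
  by apply: (cvg_comp _ _ ux); exact: continuous_foot.
have r20 : 0 < r / 2 by rewrite divr_gt0.
have h1 : \forall m \near \oo, `|foot F x - foot F (u m)| < r / 2.
  by move/cvgrPdist_lt : uf; apply.
have h2 : \forall m \near \oo, (m.+1%:R^-1 : R) < r / 2.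
  exact: (cvgr_lt _ (@cvg_harmonic R)).
near=> m; rewrite /eta; suff -> : E m (u m) = 0 by rewrite mulr0 subr0.
apply/eqP; apply: contrapT => /negP Em.
have [_ _ _ _ [/(_ _ Em)[k Kk fk] _ _]] := EL m.
suff : (~` fdom F) k by [].
apply: rK; rewrite -ball_normE /ball_ /=.
have a1 : `|foot F x - foot F (u m)| < r / 2 by near: m.
have a2 : (m.+1%:R^-1 : R) < r / 2 by near: m.
apply: le_lt_trans (ler_distD (foot F (u m)) _ _) _.
by rewrite (splitr r) ltrD//; exact: lt_trans fk a2.
Unshelve. all: by end_near. Qed.

(** The factor [eps m] compensates the [1 / eps m] produced by differentiating the rescaled height.
    The normal term survives in the limit; on [T] the other one is small by the choice of
    [eps m]. *)
Lemma grad_eta m x : eps m *: grad (eta m) x =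
  - ('D_1 bump (height F x / eps m) * E m x) *: outward F
  - bump (height F x / eps m) *: (eps m *: grad (E m) x).
Proof.
have [_ eE _ _ _] := EL m; have e0 := eps_gt0 m; have en : eps m != 0 by rewrite gt_eqF.
have D v : 'D_v (eta m) x = - ('D_1 bump (height F x / eps m) * (dot v (outward F) / eps m) * E m x
    + bump (height F x / eps m) * 'D_v (E m) x).
  have ebh := elementary_bump_height m.
  have -> : eta m = cst 1 - (fun x => bump (height F x / eps m)) * E m.
    by apply/funext => y; rewrite !fctE.
  rewrite deriveB ?derive_cst ?sub0r; first 1 last.
  - exact: derivable_cst.
  - by apply: derivable_elementary; exact: elementaryM.
  rewrite deriveM; [|exact: derivable_elementary..].
  congr (- _); rewrite addrC /GRing.scale /=; congr (_ + _).
  rewrite mulrC; congr (_ * _).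
  have eh : elementary (fun y => height F y / eps m).
    by apply: elementaryM; [exact: elementary_height|exact: elementary_cst].
  rewrite (@derive_comp1 _ _ bump (fun y => height F y / eps m)); first 1 last.
  - by apply: derivable_elementary; exact: elementary_bump.
  - exact: differentiable_elementary.
  congr (_ * _).
  have -> : (fun y => height F y / eps m) = height F * cst (eps m)^-1.
    by apply/funext => y; rewrite fctE.
  rewrite deriveM ?derive_cst ?scaler0 ?add0r; first 1 last.
  - by apply: derivable_elementary; exact: elementary_height.
  - exact: derivable_cst.
  by rewrite /GRing.scale /= derive_dot mulrC.
by apply: E3_eq; rewrite /grad /= !D /dot /= /GRing.scale /=; field.
Qed.

End Layer.

(** * Integrals and null sets *)

Section Integrals.
Context {R : realType}.
Local Notation leb := (@lebesgue_measure R).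
Local Notation M := (measurableTypeR R).
Local Notation M2 := (M * M)%type.
Local Notation M3 := (M * M * M)%type.

Lemma Rdominated_convergence d (X : measurableType d)
    (mu : {measure set X -> \bar R}) (D : set X) (f_ : nat -> X -> R)
    (f g : X -> R) : measurable D ->
  (forall n, measurable_fun D (f_ n)) -> measurable_fun D f ->
  {ae mu, forall x, D x -> f_ ^~ x @ \oo --> f x} ->
  mu.-integrable D (EFin \o g) ->
  (forall n x, D x -> `|f_ n x| <= g x) ->
  mu.-integrable D (EFin \o f) /\
  \int[mu]_(x in D) f_ n x @[n --> \oo] --> \int[mu]_(x in D) f x.
Proof.
move=> mD mf_ mf fcv ig fg.
have [|||||if_ _ h] := @dominated_convergence _ X R mu D mD
    (fun n => EFin \o f_ n) (EFin \o f) (EFin \o g).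
- by move=> n; exact/measurable_EFinP.
- exact/measurable_EFinP.
- apply: filterS fcv => x fx Dx; by apply: cvg_EFin; [exact: nearW|exact: fx].
- exact: ig.
- by apply: aeW => x n Dx; rewrite /= lee_fin fg.
split => //; apply: fine_cvg.
rewrite /Rintegral fineK//; exact: integrable_fin_num.
Qed.

(** The formula for nonnegative functions is applied to the positive and negative parts, whose
    integrals are finite and can be subtracted. *)
Lemma integrable_change (a b c o : E3 R) (f : E3 R -> R) : det3 a b c != 0 ->
  leb3.-integrable [set: M3] (EFin \o (f : M3 -> R)) ->
  \int[leb3]_x f x =
  `|det3 a b c| * \int[leb3]_y f (o + y.1.1 *: a + y.1.2 *: b + y.2 *: c).
Proof.
move=> d fi; have mf : measurable_fun [set: M3] (f : M3 -> R).
  by apply/measurable_EFinP; case/integrableP: fi.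
pose X (y : M3) : M3 := o + y.1.1 *: a + y.1.2 *: b + y.2 *: c.
have mX : measurable_fun [set: M3] X by exact: measurable_lin.
have P := change_var_det d.
have mp : measurable_fun [set: M3] (EFin \o f)^\+%E.
  by apply: measurable_funepos; exact/measurable_EFinP.
have mn : measurable_fun [set: M3] (EFin \o f)^\-%E.
  by apply: measurable_funeneg; exact/measurable_EFinP.
have Ep := P o _ mp (fun x => funepos_ge0 _ x).
have En := P o _ mn (fun x => funeneg_ge0 _ x).
have d0 : 0 < `|det3 a b c| by rewrite normr_gt0.
have di : (0 <= `|det3 a b c|^-1%:E)%E by rewrite lee_fin invr_ge0 ltW.
have fp : (\int[leb3]_x (EFin \o f)^\+ x)%E \is a fin_num.
  by apply: integrable_fin_num => //; apply: integrable_funepos.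
have fn : (\int[leb3]_x (EFin \o f)^\- x)%E \is a fin_num.
  by apply: integrable_fin_num => //; apply: integrable_funeneg.
have inv t : (`|det3 a b c|^-1%:E * (`|det3 a b c|%:E * t) = t)%E.
  by rewrite muleA -EFinM mulVf ?mul1e// gt_eqF.
have fpX := congr1 (fun t => `|det3 a b c|^-1%:E * t)%E Ep.
have fnX := congr1 (fun t => `|det3 a b c|^-1%:E * t)%E En.
rewrite !inv in fpX fnX.
have EX : (\int[leb3]_y (f (X y))%:E =
    \int[leb3]_y (EFin \o f)^\+ (X y) - \int[leb3]_y (EFin \o f)^\- (X y))%E.
  rewrite integralE; congr (_ - _)%E; apply: eq_integral => y _.
    by rewrite !funeposE.
  by rewrite !funenegE.
rewrite /Rintegral EX [in LHS]integralE -fpX -fnX.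
rewrite -(fineK fp) -(fineK fn) -!EFinM -!EFinB /=.
by rewrite -mulrBr mulrA divff ?mul1r// gt_eqF.
Qed.

Lemma measurable_elementary (f : E3 R -> R) : elementary f ->
  measurable_fun [set: M3] (f : M3 -> R).
Proof.
move=> ef; apply: within_continuous_measurable3 => //.
exact/continuous_subspaceT/continuous_elementary.
Qed.

Lemma null_line (a b c : R) : (a, b) != (0, 0) ->
  leb2 ([set z | a * z.1 + b * z.2 = c] : set M2) = 0%E.
Proof.
move=> ab0; have [b0|b0] := eqVneq b 0.
  have a0 : a != 0 by move: ab0; rewrite b0; apply: contra => /eqP ->.
  have -> : [set z : M2 | a * z.1 + b * z.2 = c] = [set (c / a)] `*` [set: M].
    apply/seteqP; split => -[x y] /=; rewrite b0 mul0r addr0.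
      by move=> <-; split => //; rewrite mulrAC divff ?mul1r.
    by move=> [-> _]; rewrite mulrC divfK.
  rewrite [LHS](@product_measure1E _ _ _ _ _ leb leb)//.
  by rewrite [X in (X * _)%E](lebesgue_measure_set1 (c / a)) mul0e.
rewrite /leb2 /product_measure1 integral0_eq// => x _ /=.
rewrite (_ : xsection _ _ = [set ((c - a * x) / b)]) ?lebesgue_measure_set1//.
apply/seteqP; split => y; rewrite /xsection /= ?inE /=.
  by move=> <-; rewrite addrC addKr mulrAC divff ?mul1r.
by move=> ->; rewrite [b * _]mulrC divfK// addrC subrK.
Qed.

Lemma measurable_plane (F : face R) : measurable ([set x | height F x = 0] : set M3).
Proof.
rewrite (_ : [set _ | _] = [set: M3] `&` height F @^-1` [set 0]).
  exact: (measurable_elementary (elementary_height F)).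
by rewrite setTI.
Qed.

(** In the coordinates of the frame, the plane is the product of the whole plane with a single
    point. *)
Lemma null_plane (F : face R) : leb3 ([set x | height F x = 0] : set M3) = 0%E.
Proof.
set P := [set x | _].
have mP : measurable (P : set M3) by exact: measurable_plane.
transitivity (\int[leb3]_x (\1_P (x : M3))%:E)%E; first by rewrite integral_indic// setIT.
have d : det3 (fu F) (fv F) (1 *: outward F) != 0 by rewrite det3_frame oner_neq0.
have mI : measurable_fun [set: M3] (EFin \o (\1_P : M3 -> R)).
  by apply/measurable_EFinP; exact: measurable_indic.
rewrite (change_var_det d (fo F) mI); last by move=> x; rewrite lee_fin.
rewrite det3_frame normr1 mul1e.
transitivity (\int[leb3]_y (\1_([set: M2] `*` [set (0 : R)]) y : R)%:E)%E.
  apply: eq_integral => y _ /=; congr EFin; rewrite !indicE; congr (nat_of_bool _)%:R.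
  have hy : height F (fo F + y.1.1 *: fu F + y.1.2 *: fv F + y.2 *: (1 *: outward F)) = y.2.
    by rewrite scale1r; exact: (height_lift F y.1 y.2).
  apply/idP/idP; rewrite !inE /P /= hy; first by [].
  by case.
rewrite integral_indic// ?setIT; last exact: measurableX.
rewrite [LHS](@product_measure1E _ _ _ _ _ leb2sf leb)//.
by rewrite [X in (_ * X)%E](lebesgue_measure_set1 (0 : R)) mule0.
Qed.

Lemma null_segment (p q : R * R) : exists2 N : set M2, measurable N /\ leb2 N = 0%E &
  forall t : R, N ((1 - t) *: p + t *: q).
Proof.
have mline (a b c : R) : measurable ([set z | a * z.1 + b * z.2 = c] : set M2).
  have mf : measurable_fun [set: M2] (fun z : M2 => a * z.1 + b * z.2).
    by apply: measurable_funD; apply: measurable_funM.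
  rewrite (_ : [set _ | _] = [set: M2] `&` (fun z : M2 => a * z.1 + b * z.2) @^-1` [set c]).
    exact: mf.
  by rewrite setTI.
(* The endpoints may coincide, for instance when an edge orthogonal to a face is projected onto the
   plane of that face. A vertical line through the point then serves. *)
have [->|pq] := eqVneq p q.
  exists ([set z | 1 * z.1 + 0 * z.2 = q.1]); first split => //.
    apply: null_line; apply/eqP => -[/eqP]; exact/negP/oner_neq0.
  by move=> t; rewrite /= /GRing.scale /=; ring.
exists ([set z | (p.2 - q.2) * z.1 + (q.1 - p.1) * z.2 = (p.2 - q.2) * p.1 + (q.1 - p.1) * p.2]).
  split => //; apply: null_line; apply: contra pq => /eqP[/eqP + /eqP].
  rewrite !subr_eq0 => /eqP h2 /eqP h1.
  by case: p q h1 h2 => [p1 p2] [q1 q2] /= -> ->.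
by move=> t; rewrite /= /GRing.scale /=; ring.
Qed.

Lemma negligible_fin_bigcup d (X : measurableType d)
    (mu : {measure set X -> \bar R}) n (N : 'I_n -> set X) :
  (forall i, mu.-negligible (N i)) -> mu.-negligible (\bigcup_i N i).
Proof.
move=> nN; pose N' k := if insub k is Some i then N i else set0.
apply: (@negligibleS _ _ _ _ (\bigcup_k N' k)).
  by move=> x [i _ Nx]; exists (val i) => //; rewrite /N' valK.
apply: negligible_bigcup => k; rewrite /N'; case: insub => [i|]; first exact: nN.
exact: negligible_set0.
Qed.

Variable T : polyhedron R.

(** The relative boundary of a face is a union of finitely many edges by [ph_polygonal]. The map
    [foot] is affine and inverts the chart, so it sends each edge into a null line. *)
Lemma negligible_face_bound i :
  leb2.-negligible (fdom (ph_face (p := T) i) `\` (fdom (ph_face i))° : set M2).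
Proof.
set F := ph_face i.
have /choice[N HN] : forall e : 'I_(nedges T), exists N : set M2,
    (measurable N /\ leb2 N = 0%E) /\ (forall t : R, N ((1 - t) *: foot F (ph_edge e).1 + t *: foot F (ph_edge e).2)).
  by move=> e; have [N N0 NP] := null_segment (foot F (ph_edge e).1) (foot F (ph_edge e).2); exists N.
have negN : leb2.-negligible (\bigcup_e N e).
  apply: negligible_fin_bigcup => e; exists (N e).
  by have [[mN N0] _] := HN e; split.
apply: negligibleS negN => z Kz.
have : face_bound F (chart F z) by exists z.
rewrite /F ph_polygonal => -[e _ [t _ tE]].
exists e => //; have [_ /(_ t)] := HN e.
suff -> : (1 - t) *: foot F (ph_edge e).1 + t *: foot F (ph_edge e).2 = z by [].
rewrite -[RHS](foot_chart F) -tE.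
by rewrite /foot /dot; congr pair; rewrite /= /GRing.scale /=; ring.
Qed.

Lemma negligible_boundary : leb3.-negligible (T `\` T° : set M3).
Proof.
rewrite ph_boundary; apply: negligible_fin_bigcup => i.
exists [set x | height (ph_face i) x = 0]; split.
- exact: measurable_plane.
- exact: null_plane.
- by move=> _ [z _ <-]; exact: height_chart.
Qed.

End Integrals.

(** * The contribution of one face *)

Section BumpDerivative.
Context {R : realType}.
Local Notation leb := (@lebesgue_measure R).
Local Notation dbump := ('D_(1 : R) (@bump R)).

Lemma elementary_dbump : elementary dbump.
Proof. by have := elementary_derive (1 : R) (@elementary_bump R). Qed.

Lemma dbump0 t : 2 < `|t| -> dbump t = 0.
Proof.
move=> t2; transitivity ('D_(1 : R) (fun=> 0 : R) t); last exact: derive_cst.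
apply: near_eq_derive.
have ct : id x @[x --> t] --> t by exact: cvg_id.
have := cvgr_norm_gt _ ct _ t2.
move=> H2; near=> s; rewrite bump0// ltW//; near: s; exact: H2.
Unshelve. all: by end_near.
Qed.

Lemma dbump_bound : exists2 C : R, 0 < C & forall t, `|dbump t| <= C.
Proof.
have ck : compact (dbump @` `[(-2 : R), 2]).
  apply: continuous_compact; last exact: segment_compact.
  exact/continuous_subspaceT/continuous_elementary/elementary_dbump.
have [C C0 HC] := compact_norm_bound ck; exists C => // t.
have [t2|t2] := ltrP 2 `|t|; first by rewrite dbump0// normr0 ltW.
by apply: HC; exists t => //; rewrite /= in_itv /= -ler_norml.
Qed.

Let dbump_restrict : (fun s : R => if s < 0 then dbump s else 0) =
  dbump \_ `[(-2), 0[%classic.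
Proof.
apply/funext => s; rewrite patchE mem_setE in_itv /=.
case: (ltrP s 0) => [s0|s0]; last by rewrite andbF.
rewrite andbT; case: ifPn => //; rewrite -ltNge => s2; rewrite dbump0//.
by rewrite ltr0_norm//; lra.
Qed.

Lemma integrable_dbump : leb.-integrable setT
  (EFin \o (fun s : R => if s < 0 then dbump s else 0)).
Proof.
have H : leb.-integrable `[(-2 : R), 0]%classic (EFin \o dbump).
  apply: continuous_compact_integrable; first exact: segment_compact.
  by apply: continuous_subspaceT; exact: continuous_elementary elementary_dbump.
have mD : measurable (`[(-2 : R), 0[%classic : set (measurableTypeR R)) by exact: measurable_itv.
have H' : leb.-integrable (`[(-2 : R), 0[%classic) (EFin \o dbump).
  apply: (@integrableS _ _ _ leb _ _ _ _ mD _ H) => //.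
  by apply: subset_itvl; rewrite bnd_simp.
rewrite dbump_restrict -restrict_EFin.
exact: ((integrable_mkcond _ mD).1 H').
Qed.

(** Fundamental theorem of calculus on [-2, 0]: the value is [bump 0 - bump (-2)]. This normalizes
    the flux in the limit. *)
Lemma integral_dbump :
  (\int[leb]_s (if (s < 0)%R then dbump s else 0%R)%:E = 1)%E.
Proof.
have cb : continuous dbump by exact: continuous_elementary elementary_dbump.
have -> : (\int[leb]_s (if (s < 0)%R then dbump s else 0%R)%:E =
    \int[leb]_(s in `[(-2)%R, 0%R[) (dbump s)%:E)%E.
  rewrite [RHS]integral_mkcond restrict_EFin -dbump_restrict.
  by apply: eq_integral.
rewrite integral_itv_bndo_bndc; last first.
  by apply/measurable_EFinP; apply: measurable_funTS; exact: continuous_measurable_fun.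
rewrite (@continuous_FTC2 _ _ bump)//.
- by rewrite (@bump0 _ (-2)) ?bump1 ?normr0 ?normrN ?ger0_norm// -EFinB subr0.
- exact: continuous_subspaceT.
- have cbu := continuous_elementary (@elementary_bump R).
  split.
  + by move=> s _; apply: derivable_elementary; exact: elementary_bump.
  + by apply: cvg_at_right_filter; exact: cbu.
  + by apply: cvg_at_left_filter; exact: cbu.
- by move=> s _; rewrite derive1E.
Qed.

End BumpDerivative.

Section FaceLimit.
Context {R : realType}.
Local Notation M3 := (measurableTypeR R * measurableTypeR R * measurableTypeR R)%type.

Lemma dotZr k (a b : E3 R) : dot a (k *: b) = k * dot a b.
Proof. by rewrite dotC dotZl dotC. Qed.

Lemma dotBr (a b c : E3 R) : dot a (b - c) = dot a b - dot a c.
Proof. by rewrite dotC dotBl !(dotC a). Qed.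

(** The norm on the product type is the maximum norm, hence the factor 3. *)
Lemma dot_norm (a b : E3 R) : `|dot a b| <= 3 * (`|a| * `|b|).
Proof.
have h (c : E3 R) : [/\ `|c.1.1| <= `|c|, `|c.1.2| <= `|c| & `|c.2| <= `|c|].
  by split; rewrite prod_normE ?le_max ?lexx ?orbT//= prod_normE le_max le_max lexx ?orbT.
have [a1 a2 a3] := h a; have [b1 b2 b3] := h b.
apply: (le_trans (ler_normD _ _)); apply: (le_trans (lerD (ler_normD _ _) (lexx _))).
rewrite !normrM.
have := ler_pM (normr_ge0 _) (normr_ge0 _) a1 b1.
have := ler_pM (normr_ge0 _) (normr_ge0 _) a2 b2.
have := ler_pM (normr_ge0 _) (normr_ge0 _) a3 b3.
lra.
Qed.

Lemma cvg_dot (u v : nat -> E3 R) (a b : E3 R) :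
  u @ \oo --> a -> v @ \oo --> b -> dot (u n) (v n) @[n --> \oo] --> dot a b.
Proof.
have [c1 c2 c3] := @continuous_E3 R.
move=> ua vb; apply: cvgD; [apply: cvgD|]; apply: cvgM.
- exact: cvg_comp ua (c1 a).
- exact: cvg_comp vb (c1 b).
- exact: cvg_comp ua (c2 a).
- exact: cvg_comp vb (c2 b).
- exact: cvg_comp ua (c3 a).
- exact: cvg_comp vb (c3 b).
Qed.

Variables (T : polyhedron R) (w : E3 R -> E3 R) (tau : E3 R -> R).
Hypotheses (cw : {within region T, continuous w}) (et : elementary tau).
Variables (eps : 'I_(nfaces T) -> nat -> R) (E : 'I_(nfaces T) -> nat -> E3 R -> R).
Hypothesis EL : forall i, layer (ph_face i) T (eps i) (E i).

Definition cutoff i m := eta (ph_face i) (eps i) (E i) m.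

(** The part of minus [w] times the gradient of [tau] times all cutoffs in which the derivative
    falls on the cutoff of face [i]. This sign makes it tend to the outward flux. *)
Definition boundary_term i m (x : E3 R) : R :=
  - (tau x * dot (w x) (grad (cutoff i m) x)) * \prod_(j | j != i) cutoff j m x.

Lemma face_sub_boundary i : face_set (ph_face (p := T) i) `<=` T `\` T°.
Proof. by move=> x Fx; rewrite ph_boundary; exists i. Qed.

Lemma measurable_region : measurable (T : set M3).
Proof. by apply: compact_measurable3; exact: ph_compact. Qed.

Lemma continuous_field_comp (h : E3 R -> R) : continuous h -> {within region T, continuous (h \o w)}.
Proof.
move=> ch; apply/subspace_continuousP => x Tx.
move/subspace_continuousP : cw => /(_ x Tx) wx.
exact: cvg_comp wx (ch _).
Qed.

Lemma measurable_continuous_field : [/\ measurable_fun (T : set M3) (fun x => (w x).1.1),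
  measurable_fun (T : set M3) (fun x => (w x).1.2) &
  measurable_fun (T : set M3) (fun x => (w x).2)].
Proof.
have [c1 c2 c3] := @continuous_E3 R; have mT := measurable_region.
split; apply: within_continuous_measurable3 => //.
- exact: continuous_field_comp c1.
- exact: continuous_field_comp c2.
- exact: continuous_field_comp c3.
Qed.

Lemma measurable_dot (v : E3 R -> E3 R) (D : set (E3 R)) :
  D `<=` T -> measurable (D : set M3) ->
  measurable_fun (D : set M3) (fun x => (v x).1.1) ->
  measurable_fun (D : set M3) (fun x => (v x).1.2) ->
  measurable_fun (D : set M3) (fun x => (v x).2) ->
  measurable_fun (D : set M3) (fun x => dot (w x) (v x)).
Proof.
move=> DT mD m1 m2 m3; have [w1 w2 w3] := measurable_continuous_field.
have mT := measurable_region.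
by apply: measurable_funD; [apply: measurable_funD|]; apply: measurable_funM => //;
  exact: measurable_funS DT _.
Qed.

Lemma elementary_cutoff i m : elementary (cutoff i m).
Proof. exact: elementary_eta (EL i) m. Qed.

Lemma elementary_cutoffs i m : elementary (fun x => \prod_(j | j != i) cutoff j m x).
Proof. by apply: elementary_prod => j _; exact: elementary_cutoff. Qed.

Lemma measurable_boundary_term i m :
  measurable_fun (T : set M3) (boundary_term i m).
Proof.
have mT := measurable_region.
have me (f : E3 R -> R) : elementary f -> measurable_fun (T : set M3) f.
  by move=> ef; apply: measurable_funTS; exact: measurable_elementary.
apply: measurable_funM; last by apply: me; exact: elementary_cutoffs.
apply: measurable_funN; apply: measurable_funM; first exact: me.
by apply: measurable_dot => //; apply: me; apply: elementary_derive; exact: elementary_cutoff.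
Qed.

Lemma continuous_field_bound : exists2 N : R, 0 < N & forall x, region T x -> `|w x| <= N.
Proof.
have ck : compact (w @` T) by apply: continuous_compact => //; exact: ph_compact.
by have [N N0 HN] := compact_norm_bound ck; exists N => // x Tx; apply: HN; exists x.
Qed.

Lemma elementary_bound (f : E3 R -> R) : elementary f ->
  exists2 N : R, 0 < N & forall x, region T x -> `|f x| <= N.
Proof.
move=> ef; have ck : compact (f @` T).
  apply: continuous_compact; last exact: ph_compact.
  exact/continuous_subspaceT/continuous_elementary.
by have [N N0 HN] := compact_norm_bound ck; exists N => // x Tx; apply: HN; exists x.
Qed.

Lemma prod_cutoff01 i m x : 0 <= \prod_(j | j != i) cutoff j m x <= 1.
Proof.
elim/big_ind: _ => [|x1 x2 /andP[a0 a1] /andP[b0 b1]|j _].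
- by rewrite ler01 lexx.
- by rewrite mulr_ge0//= mulr_ile1.
- exact: eta01 (EL j) m x.
Qed.

Section OneFace.
Variable i : 'I_(nfaces T).
Let F := ph_face i.
Let n := outward F.
Let e := eps i.

Lemma scaled_boundary_term m x : e m * boundary_term i m x =
  tau x * ('D_1 bump (height F x / e m) * E i m x * dot (w x) n
    + bump (height F x / e m) * dot (w x) (e m *: grad (E i m) x))
  * \prod_(j | j != i) cutoff j m x.
Proof.
rewrite /boundary_term mulrA; congr (_ * _).
rewrite mulrN mulrCA -dotZr (grad_eta (EL i)) -/F -/n -/e dotBr !dotZr; ring.
Qed.

(** [E i m x] is kept in the bound for two uses: estimated by 1, it gives a constant independent of
    [m]; where it vanishes, the bound tends to 0. The second clause confines the support, since
    beyond 2 both [bump] and its derivative are zero. *)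
Lemma scaled_boundary_term_le : exists2 C : R, 0 < C & forall m x, region T x ->
  `|e m * boundary_term i m x| <= C * (m.+1%:R^-1 + E i m x) /\
  (2 < `|height F x / e m| -> e m * boundary_term i m x = 0).
Proof.
have [Nw Nw0 HNw] := continuous_field_bound; have [Nt Nt0 HNt] := elementary_bound et.
have [Cb Cb0 HCb] := @dbump_bound R.
(* [Nt], [Nw] and [Cb] bound [tau], [w] and the derivative of [bump]; the 3 is that of [dot_norm],
   and the final 1 bounds [bump] in the term with the gradient of [E]. *)
pose C := Nt * (3 * (Nw * (Cb * `|n| + 1))).
exists C => [|m x Tx].
  by rewrite /C !mulr_gt0// ltr_wpDl// mulr_ge0// ltW.
rewrite scaled_boundary_term; split; last first.
  by move=> h2; rewrite dbump0// bump0 ?(ltW h2)// !mul0r add0r mulr0 mul0r.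
have [_ _ /(_ x)/andP[E0 E1] _ [_ gE _]] := EL i m.
have /andP[P0 P1] := prod_cutoff01 i m x.
have Bg := bump_ge0 (height F x / e m); have Bl := bump_le1 (height F x / e m).
move: (bump (height F x / e m)) Bg Bl => B Bg Bl.
rewrite normrM (ger0_norm P0); apply: (@le_trans _ _ (`|tau x * ('D_1 bump (height F x / e m) * E i m x * dot (w x) n
    + B * dot (w x) (e m *: grad (E i m) x))| * 1)).
  by apply: ler_wpM2l.
rewrite mulr1 normrM /C -[leRHS]mulrA; apply: ler_pM => //; first exact: HNt.
apply: (le_trans (ler_normD _ _)); rewrite !normrM (ger0_norm E0).
rewrite (ger0_norm Bg).
have d1 : `|dot (w x) n| <= 3 * (Nw * `|n|).
  by apply: (le_trans (dot_norm _ _)); rewrite ler_pM2l// ler_wpM2r// HNw.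
have m0 : (0 : R) < m.+1%:R^-1 by rewrite invr_gt0.
have d2 : `|dot (w x) (e m *: grad (E i m) x)| <= 3 * (Nw * m.+1%:R^-1).
  apply: (le_trans (dot_norm _ _)); rewrite ler_pM2l//; apply: ler_pM => //; first exact: HNw.
  exact: gE.
have t1 : `|'D_1 bump (height F x / e m)| * E i m x * `|dot (w x) n| <= Cb * E i m x * (3 * (Nw * `|n|)).
  apply: ler_pM => //; first by rewrite mulr_ge0.
  by rewrite ler_wpM2r.
have t2 : B * `|dot (w x) (e m *: grad (E i m) x)| <= 1 * (3 * (Nw * m.+1%:R^-1)).
  by apply: ler_pM.
apply: (le_trans (lerD t1 t2)).
rewrite mul1r -subr_ge0.
have -> : 3 * (Nw * (Cb * `|n| + 1)) * (m.+1%:R^-1 + E i m x) -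
  (Cb * E i m x * (3 * (Nw * `|n|)) + 3 * (Nw * m.+1%:R^-1)) =
  3 * Nw * (Cb * `|n| * m.+1%:R^-1 + E i m x) by ring.
by rewrite !mulr_ge0// ?addr_ge0 ?mulr_ge0// ?ltW// mulr_ge0// ltW.
Qed.

End OneFace.
End FaceLimit.

(** * Stretching the layer at one face *)

Section OneFaceLimit.
Context {R : realType}.
Local Notation leb := (@lebesgue_measure R).
Local Notation M := (measurableTypeR R).
Local Notation M2 := (M * M)%type.
Local Notation M3 := (M * M * M)%type.

Variables (T : polyhedron R) (w : E3 R -> E3 R) (tau : E3 R -> R).
Hypotheses (cw : {within region T, continuous w}) (et : elementary tau).
Variables (eps : 'I_(nfaces T) -> nat -> R) (E : 'I_(nfaces T) -> nat -> E3 R -> R).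
Hypothesis EL : forall i, layer (ph_face i) T (eps i) (E i).
Variable i : 'I_(nfaces T).
Let F := ph_face i.
Let n := outward F.
Let e := eps i.
Let bt m := boundary_term w tau eps E i m.

(** The normal coordinate is measured in units of the thickness. The factor [e m] in [G] below is
    the Jacobian of this map, so that [G m] has the same integral as the boundary term on [T]. *)
Let stretch m (y : E3 R) := lift_face F y.1 (e m * y.2).
Let G m (y : E3 R) : R := ((fun x => e m * bt m x) \_ (region T)) (stretch m y).
Let flux (z : R * R) : R := tau (chart F z) * dot (w (chart F z)) n.
Let Glim (y : E3 R) : R :=
  if y.2 < 0 then (flux \_ (fdom F)) y.1 * 'D_(1 : R) bump y.2 else 0.

Let e_gt0 m : 0 < e m. Proof. exact: eps_gt0 (EL i) m. Qed.

Let stretchE m y : stretch m y =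
  fo F + y.1.1 *: fu F + y.1.2 *: fv F + y.2 *: (e m *: n).
Proof. by rewrite /stretch /lift_face scalerA [_ * e m]mulrC. Qed.

Let height_stretch m y : height F (stretch m y) / e m = y.2.
Proof. by rewrite height_lift mulrC mulKf// gt_eqF. Qed.

Let foot_stretch m y : foot F (stretch m y) = y.1.
Proof. exact: foot_lift. Qed.

Let measurable_stretch m : measurable_fun [set: M3] (stretch m : M3 -> M3).
Proof.
rewrite (_ : stretch m = fun y =>
   fo F + y.1.1 *: fu F + y.1.2 *: fv F + y.2 *: (e m *: n)); last first.
  by apply/funext => y; exact: stretchE.
exact: measurable_lin.
Qed.

Let measurable_G m : measurable_fun [set: M3] (G m).
Proof.
apply: (measurableT_comp _ (measurable_stretch m)).
apply/(measurable_restrict _ _ _) => //; first exact: measurable_region.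
rewrite setTI; apply: measurable_funM => //.
exact: measurable_boundary_term.
Qed.

(** The cube is the same for all [m]: stretching keeps the foot point, which ranges over a bounded
    set for points of [T], and the stretched normal coordinate is at most 2 in absolute value on the
    support. This is what dominates the sequence. *)
Let cube_bound : exists2 C : R, 0 <= C &
  exists N : R, forall m y, `|G m y| <= C * \1_(cube3 N) y.
Proof.
have [C C0 HC] := scaled_boundary_term_le cw et EL i.
have cf : compact (foot F @` region T).
  apply: continuous_compact; last exact: ph_compact.
  exact/continuous_subspaceT/continuous_foot.
have [N N0 HN] := compact_norm_bound cf.
have G0 m y : G m y != 0 -> region T (stretch m y) /\ `|y.2| <= 2.
  rewrite /G patchE; case: ifPn => [Ty|]; last by rewrite eqxx.
  have {}Ty := set_mem Ty; move=> Gy; split=> //.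
  rewrite leNgt; apply: contra Gy => y2; apply/eqP.
  by have [_] := HC m _ Ty; apply; rewrite height_stretch.
exists (C * 2); first by rewrite mulr_ge0// ltW.
exists (N + 2) => m y; have [->|Gy] := eqVneq (G m y) 0.
  by rewrite normr0 !mulr_ge0 ?(ltW C0).
have [Ty y2] := G0 _ _ Gy.
have N2 : (0 : R) <= 2 by [].
have Ny : cube3 (N + 2) y.
  have y1 : `|y.1| <= N by rewrite -(foot_stretch m y); apply: HN; exists (stretch m y).
  apply: norm_cube3; rewrite prod_normE ge_max; apply/andP; split.
    by apply: (le_trans y1); rewrite lerDl.
  by apply: (le_trans y2); rewrite lerDr ltW.
rewrite indicE (mem_set Ny) mulr1 /G patchE (mem_set Ty).
apply: (le_trans (HC m _ Ty).1); rewrite ler_pM2l// (_ : 2 = 1 + 1); last by ring.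
apply: lerD.
  by rewrite invf_le1 ?ltr0n// ler1n.
by have [_ _ /(_ (stretch m y))/andP[]] := EL i m.
Qed.

Let cvg_stretch y : stretch m y @[m --> \oo] --> chart F y.1.
Proof.
have -> : (fun m => stretch m y) = (fun m => chart F y.1 + (e m * y.2) *: n).
  by apply/funext => m; rewrite /stretch lift_faceE.
rewrite -[X in _ --> X]addr0; apply: cvgD; first exact: cvg_cst.
rewrite -(scale0r n); apply: cvgZr_tmp; rewrite -(mul0r y.2).
by apply: cvgMr_tmp; exact: eps_cvg0 (EL i).
Qed.

Let near_right (P : R -> Prop) (t : nat -> R) : (forall m, 0 < t m) ->
  t @ \oo --> (0 : R) -> (\forall s \near (0 : R)^'+, P s) ->
  \forall m \near \oo, P (t m).
Proof.
move=> t0 tc; rewrite near_withinE => H.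
have tH : \forall m \near \oo, 0 < t m -> P (t m) by exact: (tc _ H).
by apply: filterS tH => m; apply.
Qed.

(** The foot point of [stretch m y] is always [y.1], at a positive distance from the face. Once
    [m.+1%:R^-1] is below it, [E i m] vanishes and the bound is a multiple of [m.+1%:R^-1]. *)
Let cvg_G_out (y : E3 R) : ~ fdom F y.1 -> G m y @[m --> \oo] --> (0 : R).
Proof.
move=> Ky; have [C C0 HC] := scaled_boundary_term_le cw et EL i.
have cK : closed (fdom F) by apply: compact_closed; [exact: norm_hausdorff|exact: fdom_compact].
have : nbhs y.1 (~` fdom F).
  by apply: open_nbhs_nbhs; split => //; exact: closed_openC.
move=> /nbhs_ballP[r /= r0 rK].
have hr : \forall m \near \oo, (m.+1%:R^-1 : R) < r.
  exact: (cvgr_lt _ (@cvg_harmonic R)).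
apply: norm_cvg0; apply: (@squeeze_cvgr _ _ _ _ (fun=> 0) (fun m => C * m.+1%:R^-1)).
- near=> m; rewrite normr_ge0 /= /G patchE; case: ifPn => [Ty|_]; last first.
    by rewrite normr0 mulr_ge0// ltW.
  have {}Ty := set_mem Ty; apply: (le_trans (HC m _ Ty).1).
  suff -> : E i m (stretch m y) = 0 by rewrite addr0.
  apply/eqP; apply: contrapT => /negP Em.
  have [_ _ _ _ [/(_ _ Em)[k Kk fk] _ _]] := EL i m.
  suff : (~` fdom F) k by [].
  apply: rK; rewrite -ball_normE /ball_ /= -(foot_stretch m y).
  by apply: (lt_trans fk); near: m.
- exact: cvg_cst.
- by rewrite -(mulr0 C); apply: cvgMl_tmp; exact: cvg_harmonic.
Unshelve. all: by end_near. Qed.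

(** Two faces meet only along their relative boundaries, and the chart is injective. Over the
    relative interior of [F] the other cutoffs can therefore be taken to their limit 1. *)
Let face_notin j (y : R * R) : (fdom F)° y -> j != i -> ~ face_set (ph_face (p := T) j) (chart F y).
Proof.
move=> Ky ji Fj; have : face_bound F (chart F y).
  apply: (@ph_faces_meet _ T i j); first by rewrite eq_sym.
  by split => //; exists y => //; exact: interior_subset.
move=> [z [_ Kz] zE]; apply: Kz.
by rewrite -(foot_chart F z) zE foot_chart.
Qed.

Let cvg_prod_cutoff (y : E3 R) : (fdom F)° y.1 ->
  (\prod_(j | j != i) cutoff eps E j m (stretch m y)) @[m --> \oo] --> (1 : R).
Proof.
move=> Ky.
have : \forall m \near \oo, forall j, j != i -> cutoff eps E j m (stretch m y) = 1.
  apply: filter_forall => j; have [ji|ji] := eqVneq j i; first by apply: nearW.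
  have := eta_eventually1 (EL j) (face_notin Ky ji) (@cvg_stretch y).
  by apply: filterS.
move=> H; apply: cvg_near_cst; near=> m.
apply: big1 => j ji; suff : forall j, j != i -> cutoff eps E j m (stretch m y) = 1 by apply.
by near: m.
Unshelve. all: by end_near. Qed.

Let cvg_w (u : nat -> E3 R) c : region T c -> u @ \oo --> c ->
  (\forall m \near \oo, region T (u m)) -> w (u m) @[m --> \oo] --> w c.
Proof.
move=> Tc uc Tu; move/subspace_continuousP : cw => /(_ c Tc) wc A /wc.
rewrite /nbhs /= /within /= => wA.
have := uc _ wA; rewrite /nbhs /= => h.
by apply: filterS2 h Tu => m /[apply].
Qed.

Let cvg_G (y : E3 R) : ~ (fdom F `\` (fdom F)°) y.1 -> G m y @[m --> \oo] --> Glim y.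
Proof.
move=> yN; have [Ky|Ky] := pselect (fdom F y.1); last first.
  rewrite (_ : Glim y = 0); first exact: cvg_G_out.
  by rewrite /Glim patchE memNset// mul0r if_same.
have iKy : (fdom F)° y.1 by apply: contrapT => h; apply: yN.
set c := chart F y.1.
have Fc : face_set F c by exists y.1.
have [Tc _] : (region T `\` T°) c by apply: face_sub_boundary; exact: Fc.
have ce : e @ \oo --> (0 : R) by exact: eps_cvg0 (EL i).
(* By [ph_outward] the stretched point is eventually inside [T] for negative [y.2] and outside for
   positive [y.2], where the truncation gives 0. For [y.2 = 0] it is a point of the face, near which
   the cutoff is constant and has no gradient. *)
have [y0|y0|y0] := ltrgtP y.2 0.
- have Tu : \forall m \near \oo, region T (stretch m y).
    have tp m : 0 < e m * - y.2 by rewrite mulr_gt0// oppr_gt0.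
    have tc : e m * - y.2 @[m --> \oo] --> (0 : R).
      by rewrite -(mul0r (- y.2)); apply: cvgMr_tmp.
    have := near_right tp tc (ph_outward iKy); apply: filterS => m [Tm _].
    apply: interior_subset; rewrite /stretch lift_faceE.
    by move: Tm; rewrite mulrN scaleNr opprK.
  rewrite /Glim y0 patchE mem_set//.
  (* The limit is put in the shape of [scaled_boundary_term]: the 0 stands for the limit of [e m]
     times the gradient of [E i m], and the last 1 for that of the other cutoffs. *)
  have -> : flux y.1 * 'D_1 bump y.2 = tau c * ('D_1 bump y.2 * 1 * dot (w c) n + bump y.2 * dot (w c) 0) * 1.
    by rewrite /flux -/c /dot /=; ring.
  have wu := cvg_w Tc (@cvg_stretch y) Tu.
  have gu : (e m *: grad (E i m) (stretch m y)) @[m --> \oo] --> (0 : E3 R).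
    apply: norm_cvg0; apply: (@squeeze_cvgr _ _ _ _ (fun=> 0) (fun m => m.+1%:R^-1)).
    + apply: filterS Tu => m Tm; rewrite normr_ge0 /=.
      by have [_ _ _ _ [_ /(_ _ Tm)]] := EL i m.
    + exact: cvg_cst.
    + exact: cvg_harmonic.
  have L : tau (stretch m y) * ('D_1 bump y.2 * 1 * dot (w (stretch m y)) n +
       bump y.2 * dot (w (stretch m y)) (e m *: grad (E i m) (stretch m y))) *
     \prod_(j | j != i) cutoff eps E j m (stretch m y) @[m --> \oo] -->
     tau c * ('D_1 bump y.2 * 1 * dot (w c) n + bump y.2 * dot (w c) 0) * 1.
    apply: cvgM; last exact: cvg_prod_cutoff.
    apply: cvgM.
      by apply: (cvg_comp _ _ (@cvg_stretch y)); exact: (continuous_elementary et (x := c)).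
    apply: cvgD; apply: cvgMl_tmp.
      by apply: cvg_dot => //; exact: cvg_cst.
    exact: cvg_dot.
  apply: cvg_trans L; apply: near_eq_cvg; apply: filterS Tu => m Tm.
  rewrite /G patchE mem_set// scaled_boundary_term// height_stretch.
  have [_ _ _ E1 [_ _ Ef]] := EL i m.
  (* [E i m] depends on the foot point only, and [c], a point of the face, has the same foot
     point. *)
  rewrite (_ : E i m (stretch m y) = 1)//.
  rewrite (Ef _ c); first exact: nbhs_singleton (E1 _ Fc).
  by rewrite foot_stretch foot_chart.
- rewrite /Glim ltNge (ltW y0) /=.
  have tp m : 0 < e m * y.2 by rewrite mulr_gt0.
  have tc : e m * y.2 @[m --> \oo] --> (0 : R).
    by rewrite -(mul0r y.2); apply: cvgMr_tmp.
  apply: cvg_near_cst.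
  have := near_right tp tc (ph_outward iKy); apply: filterS => m [_ Tm].
  by rewrite /G patchE memNset// /stretch lift_faceE.
- rewrite /Glim y0 ltxx; have G0 m : G m y = 0.
    rewrite /G /stretch lift_faceE y0 mulr0 scale0r addr0 patchE mem_set//.
    rewrite /bt /boundary_term (_ : grad (cutoff eps E i m) c = 0).
      by rewrite (_ : dot (w c) 0 = 0) ?mulr0 ?oppr0 ?mul0r ?mulr0// /dot /=; ring.
    have c0 := eta_near0 (EL i) m Fc.
    have D0 v : 'D_v (cutoff eps E i m) c = 0.
      by rewrite (near_eq_derive v (g := fun=> 0)) ?derive_cst.
    by rewrite /grad !D0.
  rewrite (_ : (fun m => G m y) = fun=> 0); first exact: cvg_cst.
  by apply/funext => m; exact: G0.
Qed.

Let dominating : exists2 g : M3 -> R, leb3.-integrable [set: M3] (EFin \o g) &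
  forall m y, [set: M3] y -> `|G m y| <= g y.
Proof.
have [C C0 [N HG]] := cube_bound.
exists (fun y => C * \1_(cube3 N) y); last by move=> m y _; exact: HG.
have -> : EFin \o (fun y : M3 => C * \1_(cube3 N) y) =
    (fun y => C%:E * (\1_(cube3 N) y)%:E)%E by [].
apply: integrableZl => //; apply/integrableP; split.
  by apply/measurable_EFinP; apply: measurable_indic; exact: measurable_cube3.
under eq_integral do rewrite gee0_abs ?lee_fin//.
rewrite integral_indic//; last exact: measurable_cube3.
by rewrite setIT; exact: leb3_cube.
Qed.

Let integrable_G m : leb3.-integrable [set: M3] (EFin \o (G m : M3 -> R)).
Proof.
have [g ig Gg] := dominating; apply: le_integrable ig => //.
- by apply/measurable_EFinP; exact: measurable_G.
- move=> y _ /=; rewrite lee_fin (le_trans (Gg m y I))//; exact: ler_norm.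
Qed.

Lemma integrable_boundary_term m :
  leb3.-integrable (region T : set M3) (EFin \o (bt m : M3 -> R)).
Proof.
have mT := measurable_region T; have em := e_gt0 m.
have [C C0 HC] := scaled_boundary_term_le cw et EL i.
apply: measurable_bounded_integrable => //.
- by apply: leb3_compact_lty; exact: ph_compact.
- exact: measurable_boundary_term.
- exists (C * 2 / e m); split; first exact: num_real.
  move=> x Cx z Tz /=; apply: le_trans (ltW Cx).
  rewrite ler_pdivlMr// -[X in _ * X](gtr0_norm em) -normrM mulrC.
  apply: (le_trans (HC m _ Tz).1); rewrite ler_pM2l// (_ : 2 = 1 + 1); last by ring.
  apply: lerD; first by rewrite invf_le1 ?ltr0n// ler1n.
  by have [_ _ /(_ z)/andP[]] := EL i m.
Qed.

Let integral_G m : \int[leb3]_(x in region T) bt m x = \int[leb3]_y G m y.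
Proof.
have mT := measurable_region T.
have em := e_gt0 m; have en : e m != 0 by rewrite gt_eqF.
rewrite Rintegral_mkcond.
have ib : leb3.-integrable [set: M3] (EFin \o ((bt m \_ (region T)) : M3 -> R)).
  have := integrable_boundary_term m.
  move=> /(integrable_mkcond _ mT); congr (_.-integrable _ _).
  by apply/funext => x /=; rewrite /patch; case: ifPn.
have d : det3 (fu F) (fv F) (e m *: n) != 0 by rewrite det3_frame.
rewrite (integrable_change (fo F) d ib) det3_frame (gtr0_norm em).
have -> : (fun y => (bt m \_ (region T))
    (fo F + y.1.1 *: fu F + y.1.2 *: fv F + y.2 *: (e m *: n))) =
    (fun y => (e m)^-1 * G m y).
  apply/funext => y; rewrite -stretchE /G !patchE.
  by case: ifPn => _; [rewrite mulKf|rewrite mulr0].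
rewrite RintegralZl//.
by rewrite mulVKf.
Qed.

(** Fubini: [Glim] is the flux density in the foot point times a function of the normal coordinate
    whose integral is 1. *)
Let integral_Glim : leb3.-integrable [set: M3] (EFin \o (Glim : M3 -> R)) ->
  \int[leb3]_y Glim y = \int[leb2]_(z in fdom F) flux z.
Proof.
move=> iG; rewrite [RHS]Rintegral_mkcond /Rintegral; congr fine.
pose h z := (flux \_ (fdom F)) z.
have -> : (\int[leb3]_y (Glim y)%:E =
    \int[leb2sf]_z \int[leb]_s (Glim (z, s))%:E)%E.
  exact: (esym (@integral12_prod_meas1 _ _ _ _ _ leb2sf leb _ iG)).
apply: eq_integral => z _.
transitivity ((h z)%:E * \int[leb]_s (if (s < 0)%R then 'D_(1 : R) bump s else 0%R)%:E)%E; last first.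
  by rewrite integral_dbump mule1.
rewrite -integralZl//; last exact: integrable_dbump.
apply: eq_integral => s _; rewrite /Glim /= -EFinM; congr EFin.
by case: ifPn => // _; rewrite mulr0.
Qed.

Lemma measurable_chart_comp (h : E3 R -> R) : continuous h ->
  measurable_fun (fdom F : set M2) (fun z => h (w (chart F z))).
Proof.
move=> ch; apply: within_continuous_measurable2.
  by apply: compact_measurable2; exact: fdom_compact.
have KT z : fdom F z -> region T (chart F z).
  by move=> Kz; have [] := @face_sub_boundary _ T i (chart F z); first by exists z.
apply/subspace_continuousP => z Kz; apply: cvg_comp _ (ch _).
move/subspace_continuousP : cw => /(_ _ (KT _ Kz)) wc A /wc.
rewrite /nbhs /= /within /= => wA.
have := @continuous_chart _ F z _ wA; rewrite /nbhs /= => hA.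
by apply: filterS hA => z' /= hA' Kz'; apply: hA'; exact: KT.
Qed.

Let measurable_Glim : measurable_fun [set: M3] (Glim : M3 -> R).
Proof.
have mK : measurable (fdom F : set M2).
  by apply: compact_measurable2; exact: fdom_compact.
have mh : measurable_fun [set: M2] (flux \_ (fdom F) : M2 -> R).
  apply/(measurable_restrict _ _ _) => //; rewrite setTI.
  have [c1 c2 c3] := @continuous_E3 R.
  apply: measurable_funM.
    apply: within_continuous_measurable2 => //; apply: continuous_subspaceT => z.
    apply: (@continuous_comp _ _ _ (chart F) tau); first exact: continuous_chart.
    exact: continuous_elementary.
  by apply: measurable_funD; [apply: measurable_funD|]; apply: measurable_funM => //;
    [exact: measurable_chart_comp c1|exact: measurable_chart_comp c2|exact: measurable_chart_comp c3].
rewrite (_ : Glim = fun y => (flux \_ (fdom F)) y.1 *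
    (fun s : R => if s < 0 then 'D_(1 : R) bump s else 0) y.2); last first.
  by apply/funext => y; rewrite /Glim; case: ifPn => // _; rewrite mulr0.
apply: measurable_funM.
  by apply: (measurableT_comp mh); exact: measurable_fst.
apply: (@measurableT_comp _ _ _ _ _ _ (fun s : R => if s < 0 then 'D_(1 : R) bump s else 0)).
  apply/measurable_EFinP; exact: (measurable_int leb (@integrable_dbump R)).
exact: measurable_snd.
Qed.

Lemma boundary_term_cvg :
  \int[leb3]_(x in region T) boundary_term w tau eps E i m x @[m --> \oo] -->
  \int[leb2]_(z in fdom F) (tau (chart F z) * dot (w (chart F z)) (outward F)).
Proof.
have [A [mA A0 AP]] := negligible_face_bound i.
have ae : {ae leb3, forall y : M3, [set: M3] y -> G m y @[m --> \oo] --> Glim y}.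
  (* The exceptional set is the cylinder over a null set containing the edges of the face. *)
  exists (A `*` [set: M]); split.
  - exact: measurableX.
  - by rewrite [LHS](@product_measure1E _ _ _ _ _ leb2sf leb)// [X in (X * _)%E]A0 mul0e.
  - move=> y /= nG; split => //=; apply: AP; apply: contrapT => yA.
    by apply: nG => _; exact: cvg_G.
have [g ig Gg] := dominating.
have [iG cG] := Rdominated_convergence measurableT measurable_G measurable_Glim ae ig Gg.
rewrite -(integral_Glim iG); apply: cvg_trans cG; apply: near_eq_cvg.
by apply: nearW => m; rewrite /= -integral_G.
Qed.

End OneFaceLimit.

(** * Green's formula *)

Section Green.
Context {R : realType}.
Local Notation M3 := (measurableTypeR R * measurableTypeR R * measurableTypeR R)%type.

Lemma Rintegral_sum d (X : measurableType d) (mu : {measure set X -> \bar R})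
    (D : set X) (I : Type) (s : seq I) (f : I -> X -> R) : measurable D ->
  (forall i, mu.-integrable D (EFin \o f i)) ->
  mu.-integrable D (EFin \o (fun x => \sum_(i <- s) f i x)) /\
  \int[mu]_(x in D) (\sum_(i <- s) f i x) = \sum_(i <- s) \int[mu]_(x in D) f i x.
Proof.
move=> mD fi; elim: s => [|i s [IH1 IH2]].
  rewrite big_nil (_ : (fun x => _) = fun=> 0); last by apply/funext => x; rewrite big_nil.
  by split; [exact: integrable0|rewrite /Rintegral integral0].
rewrite big_cons (_ : (fun x => _) = fun x => f i x + \sum_(j <- s) f j x); last first.
  by apply/funext => x; rewrite big_cons.
split; last by rewrite RintegralD// IH2.
exact: (integrableD mD (fi i) IH1).
Qed.

Lemma norm_E3_le (a b c na nb nc : R) : `|a| <= na -> `|b| <= nb -> `|c| <= nc ->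
  `|(a, b, c) : E3 R| <= na + nb + nc.
Proof.
move=> ha hb hc.
have a0 := normr_ge0 a; have b0 := normr_ge0 b; have c0 := normr_ge0 c.
rewrite prod_normE /= prod_normE /= !ge_max.
by apply/andP; split; [apply/andP; split|]; lra.
Qed.

(** On a set of finite measure, integrability follows from [|g| <= 1 + g ^+ 2]. *)
Lemma L2_measurable_integrable (D : set (E3 R)) (g : E3 R -> R) : compact D -> L2 D g ->
  measurable_fun (D : set M3) g /\ leb3.-integrable (D : set M3) (EFin \o (g : M3 -> R)).
Proof.
move=> cD Lg; have mD : measurable (D : set M3) by exact: compact_measurable3.
have mg0 : measurable_fun [set: M3] (g \_ D : M3 -> R).
  by have := sub_Lfun_mfun Lg; rewrite inE.
have mg : measurable_fun (D : set M3) g.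
  by have := (measurable_restrict g mD measurableT).2 mg0; rewrite setTI.
split => //.
have i2 : leb3.-integrable (D : set M3) (EFin \o (fun x : M3 => 1 + (g \_ D) x ^+ 2)).
  apply: (@integrableD _ _ _ leb3 _ mD (fun=> 1%E) (EFin \o (fun x : M3 => (g \_ D) x ^+ 2))).
    apply: measurable_bounded_integrable => //; first exact: leb3_compact_lty.
    exact: bounded_cst.
  exact: (@integrableS _ _ _ leb3 _ _ _ measurableT mD (@subsetT _ _) (Lfun2_integrable_sqr Lg)).
apply: (le_integrable mD _ _ i2); first exact/measurable_EFinP.
move=> x Dx /=; rewrite lee_fin patchE mem_set//.
rewrite [leRHS]ger0_norm ?addr_ge0 ?sqr_ge0//.
rewrite -real_normK ?num_real//; have := sqr_ge0 (`|g x| - 1).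
rewrite !expr2; have := normr_ge0 (g x); nra.
Qed.

Variables (T : polyhedron R) (w : E3 R -> E3 R) (tau g : E3 R -> R).
Hypotheses (cw : {within region T, continuous w}) (et : elementary tau).
Hypothesis gw : is_div T w g.

Let mT : measurable (region T : set M3). Proof. exact: measurable_region. Qed.

Let cT : closed (region T).
Proof. by apply: compact_closed; [exact: norm_hausdorff|exact: ph_compact]. Qed.

(** Boundary points are included: [e] vanishes near them, so both gradients are zero there. *)
Lemma grad_cut (e : E3 R -> R) x :
  (forall y, (region T `\` T°) y -> \near y, e y = 0) -> elementary e ->
  region T x -> grad (e \_ (region T)) x = grad e x.
Proof.
move=> e0 ee Tx.
have D v : 'D_v (e \_ (region T)) x = 'D_v e x.
  by rewrite (derive_cut cT x v e0 ee) patchE mem_set.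
by rewrite /grad !D.
Qed.

Let measurable_cont (f : E3 R -> R) : elementary f -> measurable_fun (region T : set M3) f.
Proof. by move=> ef; apply: measurable_funTS; exact: measurable_elementary. Qed.

Lemma integrable_dot_elementary (f h : E3 R -> R) : elementary f -> elementary h ->
  leb3.-integrable (region T : set M3)
    (EFin \o (fun x : M3 => dot (w x) (grad f x) * h x)).
Proof.
move=> ef eh; apply: measurable_bounded_integrable => //.
- by apply: leb3_compact_lty; exact: ph_compact.
- apply: measurable_funM; last exact: measurable_cont.
  by apply: measurable_dot => //; apply: measurable_cont; exact: elementary_derive.
have [Nw Nw0 HNw] := continuous_field_bound cw.
have [Nh Nh0 HNh] := elementary_bound T eh.
have [N1 N10 HN1] := elementary_bound T (elementary_derive ((1, 0, 0) : E3 R) ef).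
have [N2 N20 HN2] := elementary_bound T (elementary_derive ((0, 1, 0) : E3 R) ef).
have [N3 N30 HN3] := elementary_bound T (elementary_derive ((0, 0, 1) : E3 R) ef).
exists (3 * (Nw * (N1 + N2 + N3)) * Nh); split; first exact: num_real.
move=> c /ltW hc x Tx /=; apply: le_trans hc; rewrite normrM.
apply: ler_pM => //; last exact: HNh.
apply: (le_trans (dot_norm _ _)); rewrite ler_pM2l//; apply: ler_pM => //; first exact: HNw.
exact: norm_E3_le (HN1 _ Tx) (HN2 _ Tx) (HN3 _ Tx).
Qed.

Let Lg : L2 T g. Proof. by case: gw. Qed.
Let mg := (L2_measurable_integrable (@ph_compact _ T) Lg).1.
Let ig := (L2_measurable_integrable (@ph_compact _ T) Lg).2.

Lemma integrable_mul_elementary (f : E3 R -> R) : elementary f ->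
  leb3.-integrable (region T : set M3) (EFin \o (fun x : M3 => g x * f x)).
Proof.
move=> ef; have [N N0 HN] := elementary_bound T ef.
have iN : leb3.-integrable (region T : set M3) (fun x : M3 => N%:E * (g x)%:E)%E.
  by apply: integrableZl.
apply: (le_integrable mT _ _ iN).
  by apply/measurable_EFinP; apply: measurable_funM => //; exact: measurable_cont.
move=> x Tx /=; rewrite lee_fin !normrM mulrC (gtr0_norm N0).
by apply: ler_pM => //; exact: HN.
Qed.

Section Approximation.
Variables (eps : 'I_(nfaces T) -> nat -> R) (E : 'I_(nfaces T) -> nat -> E3 R -> R).
Hypothesis EL : forall i, layer (ph_face i) T (eps i) (E i).

Let chi m x := \prod_i cutoff eps E i m x.

Let elementary_chi m : elementary (chi m).
Proof. by apply: elementary_prod => i _; exact: elementary_cutoff. Qed.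

(** A boundary point lies on some face, and the cutoff of that face vanishes near it. *)
Let chi_near0 m y : (region T `\` T°) y -> \near y, tau y * chi m y = 0.
Proof.
rewrite ph_boundary => -[i _ Fy].
have := eta_near0 (EL i) m Fy; apply: filterS => x cx.
by rewrite /chi (bigD1 i)//= /cutoff cx mul0r mulr0.
Qed.

Let grad_chi m x : dot (w x) (grad (fun x => tau x * chi m x) x) =
  dot (w x) (grad tau x) * chi m x - \sum_i boundary_term w tau eps E i m x.
Proof.
have D v : 'D_v (fun x => tau x * chi m x) x = 'D_v tau x * chi m x +
    \sum_i tau x * ('D_v (cutoff eps E i m) x * \prod_(j | j != i) cutoff eps E j m x).
  have -> : (fun x => tau x * chi m x) = tau * chi m by [].
  rewrite deriveM; [|exact: derivable_elementary..].
  rewrite addrC /GRing.scale /= [chi m x * _]mulrC; congr (_ + _).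
  rewrite /chi derive_prod; first by rewrite mulr_sumr.
    exact: index_enum_uniq.
  by move=> i; exact: elementary_cutoff.
have alg1 (a : E3 R) t p d1 d2 d3 : a.1.1 * (t * (d1 * p)) +
    a.1.2 * (t * (d2 * p)) + a.2 * (t * (d3 * p)) =
    - (- (t * dot a (d1, d2, d3)) * p) by rewrite /dot /=; ring.
have alg2 (a1 a2 a3 d1 d2 d3 p s1 s2 s3 : R) :
    a1 * (d1 * p) + s1 + (a2 * (d2 * p) + s2) + (a3 * (d3 * p) + s3) =
    (a1 * d1 + a2 * d2 + a3 * d3) * p + (s1 + s2 + s3) by ring.
rewrite {1 2}/dot {1 2 3}/grad !D -sumrN.
rewrite !mulrDr !mulr_sumr.
rewrite [X in _ = _ + X](_ : _ = \sum_i (w x).1.1 * (tau x * ('D_(1, 0, 0) (cutoff eps E i m) x * \prod_(j | j != i) cutoff eps E j m x))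
  + \sum_i (w x).1.2 * (tau x * ('D_(0, 1, 0) (cutoff eps E i m) x * \prod_(j | j != i) cutoff eps E j m x))
  + \sum_i (w x).2 * (tau x * ('D_(0, 0, 1) (cutoff eps E i m) x * \prod_(j | j != i) cutoff eps E j m x))); last first.
  rewrite -!big_split /=; apply: eq_bigr => i _.
  exact/esym/alg1.
exact: alg2.
Qed.

(** The definition of the distributional divergence, tested with [tau * chi m] cut to [T]. The cut
    does not show in integrals over [T]. *)
Let green_cutoff m : \int[leb3]_(x in region T) (g x * (tau x * chi m x)) =
  - (\int[leb3]_(x in region T) (dot (w x) (grad tau x) * chi m x)) +
  \sum_i \int[leb3]_(x in region T) boundary_term w tau eps E i m x.
Proof.
have e0 := @chi_near0 m.
have ee : elementary (fun x => tau x * chi m x) by exact: elementaryM.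
have [_ /(_ _ (test_fun_cut e0 ee))] := gw.
rewrite /ip /ipv => H.
have -> : \int[leb3]_(x in region T) (g x * (tau x * chi m x)) =
   \int[leb3]_(x in region T) (g x * ((fun x => tau x * chi m x) \_ (region T)) x).
  by apply: eq_Rintegral => x Tx; rewrite patchE Tx.
rewrite H; have -> : \int[leb3]_(x in region T) dot (w x) (grad ((fun x => tau x * chi m x) \_ (region T)) x) =
    \int[leb3]_(x in region T) (dot (w x) (grad tau x) * chi m x - \sum_i boundary_term w tau eps E i m x).
  apply: eq_Rintegral => x Tx; rewrite -grad_chi; congr dot.
  exact: grad_cut e0 ee (set_mem Tx).
have [i1 i2] := Rintegral_sum (index_enum 'I_(nfaces T)) mT
  (fun i => integrable_boundary_term cw et EL i m).
rewrite RintegralB//; last by apply: integrable_dot_elementary.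
by rewrite i2 opprB addrC.
Qed.

Let cvg_chi x : T° x -> chi m x @[m --> \oo] --> (1 : R).
Proof.
move=> Tx.
have H : \forall m \near \oo, forall i, cutoff eps E i m x = 1.
  apply: filter_forall => i; apply: (eta_eventually1 (EL i)); last exact: cvg_cst.
  by move=> /face_sub_boundary[_].
apply: cvg_near_cst; apply: filterS H => m cm.
by rewrite /chi big1// => i _; exact: cm.
Qed.

Let chi_norm m x : `|chi m x| <= 1.
Proof.
have /andP[c0 c1] : 0 <= chi m x <= 1.
  rewrite /chi; elim/big_ind: _ => [|x1 x2 /andP[a0 a1] /andP[b0 b1]|j _].
  - by rewrite ler01 lexx.
  - by rewrite mulr_ge0//= mulr_ile1.
  - exact: eta01 (EL j) m x.
by rewrite ger0_norm.
Qed.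

(** Dominated by [|f|]; the convergence of [chi m] to 1 holds in the interior, and the boundary is a
    null set. *)
Let cvg_integral_chi (f : E3 R -> R) : measurable_fun (region T : set M3) f ->
  leb3.-integrable (region T : set M3) (EFin \o (f : M3 -> R)) ->
  \int[leb3]_(x in region T) (f x * chi m x) @[m --> \oo] -->
  \int[leb3]_(x in region T) f x.
Proof.
move=> mf fi; have := @Rdominated_convergence R _ M3 leb3 (region T)
  (fun m x => f x * chi m x) f (fun x => `|f x|) mT.
case => //.
- by move=> m; apply: measurable_funM => //; exact: measurable_cont.
- have := negligible_boundary T; apply: negligibleS => x /= h.
  split; first by apply: contrapT => Tx; apply: h.
  move=> Tx; apply: h => _; rewrite -[X in _ --> X]mulr1.
  by apply: cvgMl_tmp; exact: cvg_chi.
- exact: integrable_norm.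
- by move=> m x Tx; rewrite normrM ler_piMr.
Qed.

Lemma green_layers : ip T g tau = - ipv T w (grad tau) +
  \sum_(i : 'I_(nfaces T)) \int[leb2]_(z in fdom (ph_face i))
    (tau (chart (ph_face i) z) * dot (w (chart (ph_face i) z)) (outward (ph_face i))).
Proof.
have c1 : \int[leb3]_(x in region T) (g x * (tau x * chi m x)) @[m --> \oo] --> ip T g tau.
  under eq_cvg do under eq_Rintegral do rewrite mulrA.
  apply: cvg_integral_chi; last exact: integrable_mul_elementary.
  by apply: measurable_funM => //; exact: measurable_cont.
have c2 : \int[leb3]_(x in region T) (dot (w x) (grad tau x) * chi m x) @[m --> \oo] --> ipv T w (grad tau).
  have h := integrable_dot_elementary et (elementary_cst _ 1).
  have E1 : (fun x : M3 => dot (w x) (grad tau x) * 1) = fun x => dot (w x) (grad tau x).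
    by apply/funext => x; rewrite mulr1.
  rewrite E1 in h; apply: cvg_integral_chi => //.
  by apply: measurable_dot => //; apply: measurable_cont; exact: elementary_derive.
have c3 : (\sum_i \int[leb3]_(x in region T) boundary_term w tau eps E i m x) @[m --> \oo] -->
  \sum_(i : 'I_(nfaces T)) \int[leb2]_(z in fdom (ph_face i))
    (tau (chart (ph_face i) z) * dot (w (chart (ph_face i) z)) (outward (ph_face i))).
  by apply: cvg_big => [|i _]; [exact: add_continuous|exact: boundary_term_cvg].
have E1 : (fun m => \int[leb3]_(x in region T) (g x * (tau x * chi m x))) =
    (fun m => - (\int[leb3]_(x in region T) (dot (w x) (grad tau x) * chi m x)) +
       \sum_i \int[leb3]_(x in region T) boundary_term w tau eps E i m x).
  by apply/funext => m; exact: green_cutoff.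
rewrite E1 in c1; rewrite -(cvg_lim (@norm_hausdorff _ R) c1).
by apply: (cvg_lim (@norm_hausdorff _ R)); apply: cvgD => //; exact: cvgN.
Qed.

End Approximation.

Lemma green : ip T g tau = - ipv T w (grad tau) +
  \sum_(i : 'I_(nfaces T)) \int[leb2]_(z in fdom (ph_face i))
    (tau (chart (ph_face i) z) * dot (w (chart (ph_face i) z)) (outward (ph_face i))).
Proof.
have /choice[p Hp] : forall i : 'I_(nfaces T), exists p : (R^nat * (nat -> E3 R -> R)),
    layer (ph_face i) T p.1 p.2.
  by move=> i; have [e [E EL]] := layer_exists (ph_face i) (@ph_compact _ T); exists (e, E).
exact: (@green_layers (fun i => (p i).1) (fun i => (p i).2)).
Qed.

End Green.

(* Imported this late because mpoly redefines the name Measure. *)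
From mathcomp Require Import -(notations) mpoly.

(** * Orthogonal projections and polynomials *)

Section Projection.
Context {R : realType} {M : lmodType R}.
Implicit Types (u v x : M) (s : seq M).

(** The recursion peels off one generator at a time, the order in which projections are built below.
    Generators may be dependent. *)
Fixpoint lspan s : set M :=
  if s is e :: s' then [set a *: e + v | a in setT & v in lspan s'] else [set 0].

Lemma lspan_lin s a u v : lspan s u -> lspan s v -> lspan s (a *: u + v).
Proof.
elim: s u v => [|e s IH] u v /=; first by move=> -> ->; rewrite scaler0 addr0.
move=> [b _ [u' su' <-]] [c _ [v' sv' <-]].
exists (a * b + c) => //; exists (a *: u' + v'); first exact: IH.
by rewrite scalerDl scalerDr scalerA !addrA; congr (_ + _); rewrite addrAC.
Qed.

Lemma lspan0 s : lspan s 0.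
Proof.
elim: s => [//|e s IH] /=; exists 0 => //; exists 0 => //.
by rewrite scale0r addr0.
Qed.

Lemma lspan_mem (T : Type) (s : seq T) (f : T -> M) (x : T) :
  List.In x s -> lspan (map f s) (f x).
Proof.
elim: s => [//|e s IH] /= [->|xs].
  by exists 1 => //; exists 0; [exact: lspan0|rewrite scale1r addr0].
by exists 0 => //; exists (f x); [exact: IH|rewrite scale0r add0r].
Qed.

Lemma lspan_ind s (P : M -> Prop) : P 0 ->
  (forall a u v, P u -> P v -> P (a *: u + v)) ->
  (forall e, List.In e s -> P e) -> forall u, lspan s u -> P u.
Proof.
move=> P0 PD; elim: s => [_ u ->//|e s IH Ps u /=].
move=> [a _ [v sv <-]]; apply: PD; first by apply: Ps; left.
by apply: IH => // e' e's; apply: Ps; right.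
Qed.

(* Only linear on D, so that it can be an integral. *)
Variables (B : M -> M -> R) (D : M -> Prop).
Hypotheses (D0 : D 0) (Dlin : forall a u v, D u -> D v -> D (a *: u + v)).
Hypothesis Blin : forall a u v x, D u -> D v -> D x ->
  B (a *: u + v) x = a * B u x + B v x.
Hypothesis Bsym : forall u v, D u -> D v -> B u v = B v u.
Hypothesis Bpos : forall u, D u -> 0 <= B u u.

(** The degenerate case of Cauchy-Schwarz: as a function of [t], the form at [t *: e + u] has no
    quadratic term, and an affine function bounded below is constant. *)
Lemma semidefinite_eq0 u e : D u -> D e -> B e e = 0 -> B u e = 0.
Proof.
move=> Du De e0.
have H t : 0 <= 2 * t * B u e + B u u.
  have Dt : D (t *: e + u) by exact: Dlin.
  have := Bpos Dt; rewrite Blin// (Bsym De Dt) (Bsym Du Dt) !Blin// e0.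
  by rewrite (Bsym De Du); lra.
apply/eqP; apply: contrapT => /negP Bue.
(* At this [t] the affine function takes the value -1. *)
have := H (- (B u u + 1) / (2 * B u e)).
rewrite (_ : 2 * _ * _ = - (B u u + 1)); first by lra.
by field.
Qed.

(** Gram-Schmidt by induction on the generators: [f] is [e] minus its projection [p] on the span of
    the others, hence orthogonal to that span, and a multiple of [f] corrects the projection [q] of
    [w]. *)
Lemma projection_exists s w : (forall e, List.In e s -> D e) -> D w ->
  exists2 q, lspan s q & forall v, lspan s v -> B q v = B w v.
Proof.
have B0 v : D v -> B 0 v = 0.
  by move=> Dv; have := @Blin (-1) 0 0 v D0 D0 Dv; rewrite scaler0 addr0 mulN1r addNr.
elim: s w => [|e s IH] w Ds Dw.
  by exists 0 => // v ->; rewrite B0// Bsym// B0.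
have De : D e by apply: Ds; left.
have Ds' e' : List.In e' s -> D e' by move=> h; apply: Ds; right.
have Dspan v : lspan s v -> D v by exact: lspan_ind.
have [p sp Hp] := IH e Ds' De; have [q sq Hq] := IH w Ds' Dw.
have Dp := Dspan _ sp; have Dq := Dspan _ sq.
pose f := -1 *: p + e; have Df : D f by exact: Dlin.
have Bf v : lspan s v -> B f v = 0.
  by move=> sv; rewrite Blin ?Hp//; [ring|exact: Dspan].
have fq c : c *: f + q = c *: e + ((- c) *: p + q).
  by rewrite /f scalerDr scaleN1r scalerN scaleNr [_ + c *: e]addrC addrA.
have fe a v : a *: e + v = a *: f + (a *: p + v).
  by rewrite /f scalerDr scaleN1r scalerN addrACA addNr add0r.
(* If [f] has length zero, then [B w f] is zero by [semidefinite_eq0], and the coefficient 0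
   satisfies the same equation. *)
clearbody f; pose c := if B f f == 0 then 0 else (B w f) / B f f.
have Hc : c * B f f = B w f.
  rewrite /c; case: eqVneq => [f0|f0]; last by rewrite divfK.
  by rewrite mul0r semidefinite_eq0.
clearbody c; exists (c *: f + q).
  by rewrite fq /=; exists c => //; exists ((- c) *: p + q) => //; exact: lspan_lin.
move=> _ [a _ [v sv <-]]; rewrite fe.
have su : lspan s (a *: p + v) by exact: lspan_lin.
move: (a *: p + v) su => u su; have Du := Dspan _ su.
have Dfq : D (c *: f + q) by exact: Dlin.
have Dfu : D (a *: f + u) by exact: Dlin.
rewrite (Bsym Dfq Dfu) (Bsym Dw Dfu) !(Blin _ Df Du) //.
rewrite (Bsym Df Dfq) (Bsym Df Dw) (Bsym Du Dfq) (Bsym Du Dw) !(Blin _ Df Dq)//.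
rewrite (Bf _ su) (Hq _ su) (Bsym Dq Df) (Bf _ sq) -Hc; ring.
Qed.

End Projection.

(** * Polynomial functions and their spanning monomials *)

Section Polynomials.
Context {R : realType}.

Definition monomial (a : 'I_3 -> nat) (x : E3 R) : R := \prod_i coord x i ^+ a i.

(** Bounding each exponent by [k] makes the exponents a finite type that can be enumerated; the
    filter then imposes the bound on the total degree. *)
Definition monomials k : seq (E3 R -> R) :=
  map (fun a : {ffun 'I_3 -> 'I_k.+1} => monomial (fun i => val (a i)))
    [seq a : {ffun 'I_3 -> 'I_k.+1} <- enum {ffun 'I_3 -> 'I_k.+1} | (\sum_i val (a i) <= k)%N].

Lemma polyfun_lin k (a : R) (u v : E3 R -> R) :
  polyfun k u -> polyfun k v -> polyfun k (a *: u + v).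
Proof.
move=> [p pk ->] [q qk ->]; exists (a *: p + q).
  apply: leq_trans (mmeasureD_le _ _ _) _; rewrite geq_max qk andbT.
  exact: leq_trans (mmeasureZ_le _ _ _) _.
by apply/funext => x; rewrite !fctE mevalD mevalZ.
Qed.

Lemma polyfun_monomial k (a : 'I_3 -> nat) : (\sum_i a i <= k)%N -> polyfun k (monomial a).
Proof.
move=> ak; exists (mpolyX R (Multinom [tuple a i | i < 3])).
  rewrite mmeasureX ltnS; change (mdeg (Multinom [tuple a i | i < 3]) <= k)%N.
  rewrite mdegE; apply: leq_trans ak; apply: leq_sum => i _.
  by rewrite mnmE.
by apply/funext => x; rewrite mevalX; apply: eq_bigr => i _; rewrite mnmE.
Qed.

Lemma lspan_sum (s : seq (E3 R -> R)) (I : eqType) (r : seq I) (c : I -> R)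
    (f : I -> E3 R -> R) : (forall i, i \in r -> lspan s (f i)) ->
  lspan s (fun x => \sum_(i <- r) c i * f i x).
Proof.
elim: r => [|i r IH] H.
  rewrite (_ : (fun x => _) = 0); first exact: lspan0.
  by apply/funext => x; rewrite big_nil.
rewrite (_ : (fun x => _) = c i *: f i + (fun x => \sum_(j <- r) c j * f j x)).
  apply: lspan_lin; first by apply: H; rewrite mem_head.
  by apply: IH => j jr; apply: H; rewrite in_cons jr orbT.
by apply/funext => x; rewrite big_cons !fctE.
Qed.

Lemma In_map (A B : Type) (f : A -> B) s e : List.In e (map f s) -> exists2 x, List.In x s & e = f x.
Proof. by move=> /List.in_map_iff[x [<- ?]]; exists x. Qed.

Lemma mem_In (T : eqType) (x : T) (s : seq T) : x \in s -> List.In x s.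
Proof. by elim: s => [//|y s IH]; rewrite in_cons => /predU1P[->|/IH]; [left|right]. Qed.

Lemma polyfun_lspan k (u : E3 R -> R) : polyfun k u -> lspan (monomials k) u.
Proof.
move=> [p pk ->]; rewrite (_ : (fun x => _) = fun x =>
    \sum_(m <- msupp p) mcoeff m p * monomial m x); last by apply/funext => x; rewrite mevalE.
apply: lspan_sum => m mp.
have mk : (\sum_i m i <= k)%N.
  (* The size of a polynomial is one more than its degree, which matches the [k.+1] in [polyfun]. *)
  by rewrite -mdegE -ltnS; apply: leq_trans (msize_mdeg_lt mp) pk.
have mi i : (m i < k.+1)%N by rewrite ltnS; apply: leq_trans mk; rewrite (bigD1 i)//= leq_addr.
pose a := [ffun i => Ordinal (mi i)].
have -> : monomial m = monomial (fun i => val (a i)).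
  by apply/funext => x; apply: eq_bigr => i _; rewrite ffunE.
apply: (@lspan_mem _ _ _ _ (fun a : {ffun 'I_3 -> 'I_k.+1} => monomial (fun i => val (a i)))).
apply: mem_In; rewrite mem_filter mem_enum andbT.
by rewrite (eq_bigr m)// => i _; rewrite ffunE.
Qed.

Lemma monomials_polyfun k e : List.In e (monomials k) -> polyfun k e.
Proof.
move=> /List.in_map_iff[a [<-]] ain; apply: polyfun_monomial.
by elim: (enum _) ain => [//|b s IH] /=; case: ifPn => [h /= [<-//|/IH]|_ /IH].
Qed.

Lemma polyfun_ind k (P : (E3 R -> R) -> Prop) : P 0 ->
  (forall a u v, P u -> P v -> P (a *: u + v)) ->
  (forall a : 'I_3 -> nat, (\sum_i a i <= k)%N -> P (monomial a)) ->
  forall u, polyfun k u -> P u.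
Proof.
move=> P0 PD Pm u /polyfun_lspan; apply: lspan_ind => // e.
rewrite /monomials => /List.in_map_iff[a [<-]].
move=> ain; apply: Pm; elim: (enum _) ain => [//|b s IH] /=.
by case: ifPn => [h /= [<-//|/IH]|_ /IH].
Qed.

Lemma coord_dot i : exists a : E3 R, forall x, coord x i = dot (x - 0) a.
Proof.
by exists (nth 0 [:: (1, 0, 0); (0, 1, 0); (0, 0, 1)] i) => x; rewrite subr0 /dot;
  case: i => -[|[|[|//]]] ?; rewrite /coord /= ?mulr1 ?mulr0 ?addr0 ?add0r.
Qed.

Lemma elementary_coord i : elementary (fun x : E3 R => coord x i).
Proof.
have [a aE] := coord_dot i; rewrite (funext aE : (fun x => coord x i) = _).
exact: elementary_dot.
Qed.

Lemma derive_coord i (x v : E3 R) : 'D_v (fun x : E3 R => coord x i) x = coord v i.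
Proof.
have [a aE] := coord_dot i; rewrite (funext aE : (fun x => coord x i) = _).
by rewrite derive_dot aE subr0.
Qed.

Lemma elementary_monomial a : elementary (monomial a).
Proof.
by apply: elementary_prod => i _; apply: elementaryX; exact: elementary_coord.
Qed.

(** When [a i = 0] the truncated subtraction leaves the exponent at 0, and the coefficient
    [(a i)%:R] cancels the term. *)
Lemma derive_monomial a (x v : E3 R) : 'D_v (monomial a) x =
  \sum_i (a i)%:R * coord v i * monomial (fun j => (a j - (j == i))%N) x.
Proof.
rewrite /monomial derive_prod; first 1 last.
- exact: index_enum_uniq.
- by move=> i; apply: elementaryX; exact: elementary_coord.
apply: eq_bigr => i _.
have -> : (fun y : E3 R => coord y i ^+ a i) = (fun y => coord y i) ^+ a i.
  by apply/funext => y; rewrite !fctE.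
rewrite deriveX; last by apply: derivable_elementary; exact: elementary_coord.
rewrite derive_coord [in RHS](bigD1 i)//= eqxx subn1 /GRing.scale /=.
rewrite -!mulrA; congr (_ * _); rewrite mulrCA; congr (_ * (_ * _)).
by apply: eq_bigr => j /negbTE ->; rewrite subn0.
Qed.

Lemma polyfun0 k : polyfun k (0 : E3 R -> R).
Proof.
exists 0; first by rewrite mmeasure0.
by apply/funext => x; rewrite meval0.
Qed.

Lemma polyfun_elementary k (u : E3 R -> R) : polyfun k u -> elementary u.
Proof.
apply: polyfun_ind => [|a f g ef eg|a _]; first exact: elementary_cst.
  by apply: elementaryD => //; apply: elementaryM => //; exact: elementary_cst.
exact: elementary_monomial.
Qed.

Lemma polyfun_derive k (u : E3 R -> R) (v : E3 R) : polyfun k u ->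
  polyfun k (fun x => 'D_v u x).
Proof.
(* Elementarity is carried through the induction because linearity of the derivative requires
   derivable functions. *)
move=> pu; suff [] : elementary u /\ polyfun k (fun x => 'D_v u x) by [].
move: u pu; apply: polyfun_ind.
- split; first exact: elementary_cst.
  rewrite (_ : (fun x => _) = 0); first exact: polyfun0.
  by apply/funext => x; exact: derive_cst.
- move=> a f g [ef pf] [eg pg]; split.
    by apply: elementaryD => //; apply: elementaryM => //; exact: elementary_cst.
  rewrite (_ : (fun x => _) = a *: (fun x => 'D_v f x) + (fun x => 'D_v g x)).
    exact: polyfun_lin.
  apply/funext => x; have df := derivable_elementary (x := x) (v := v) ef.
  by rewrite deriveD ?deriveZ//; [exact: derivableZ|exact: derivable_elementary].
- move=> a ak; split; first exact: elementary_monomial.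
  rewrite (_ : (fun x => _) = fun x => \sum_i (a i)%:R * coord v i * monomial (fun j => (a j - (j == i))%N) x).
    have : forall r : seq 'I_3, polyfun k (fun x => \sum_(i <- r) (a i)%:R * coord v i * monomial (fun j => (a j - (j == i))%N) x).
      elim=> [|i r IH].
        rewrite (_ : (fun x => _) = 0); first exact: polyfun0.
        by apply/funext => x; rewrite big_nil.
      rewrite (_ : (fun x => _) = ((a i)%:R * coord v i) *: monomial (fun j => (a j - (j == i))%N) +
         (fun x => \sum_(i <- r) (a i)%:R * coord v i * monomial (fun j => (a j - (j == i))%N) x)).
        apply: polyfun_lin => //; apply: polyfun_monomial; apply: leq_trans ak.
        by apply: leq_sum => j _; exact: leq_subr.
      by apply/funext => x; rewrite big_cons !fctE.
    exact.
  by apply/funext => x; exact: derive_monomial.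
Qed.

End Polynomials.

(** * The commutation property *)

Section BoundedFields.
Context {R : realType} d (X : measurableType d) (mu : {measure set X -> \bar R}).
Variables (D : set X) (mD : measurable D) (finD : (mu D < +oo)%E) (kappa : X -> E3 R).
Implicit Types u v w : E3 R -> E3 R.

(** With [kappa] the identity this serves for integrals over [T], and with [kappa] a chart for
    integrals over a face. It is the domain on which the inner product is known to be bilinear, all
    products being integrable. *)
Definition bounded_field u :=
  [/\ measurable_fun D (fun x => (u (kappa x)).1.1),
      measurable_fun D (fun x => (u (kappa x)).1.2),
      measurable_fun D (fun x => (u (kappa x)).2) &
      exists N : R, forall x, D x -> `|u (kappa x)| <= N].

Definition field_ip u v : R := \int[mu]_(x in D) dot (u (kappa x)) (v (kappa x)).

Lemma bounded_field_lin a u v : bounded_field u -> bounded_field v ->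
  bounded_field (a *: u + v).
Proof.
move=> [u1 u2 u3 [N HN]] [v1 v2 v3 [N' HN']]; split.
- by apply: measurable_funD => //; exact: measurable_funM.
- by apply: measurable_funD => //; exact: measurable_funM.
- by apply: measurable_funD => //; exact: measurable_funM.
exists (`|a| * N + N') => x Dx; rewrite !fctE; apply: (le_trans (ler_normD _ _)).
by rewrite normrZ lerD ?ler_wpM2l ?HN ?HN'.
Qed.

Lemma bounded_field0 : bounded_field 0.
Proof. by split; [exact: measurable_cst..|exists 0 => x _; rewrite normr0]. Qed.

Lemma integrable_field_dot u v : bounded_field u -> bounded_field v ->
  mu.-integrable D (EFin \o (fun x => dot (u (kappa x)) (v (kappa x)))).
Proof.
move=> [u1 u2 u3 [N HN]] [v1 v2 v3 [N' HN']].
apply: measurable_bounded_integrable => //.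
  by apply: measurable_funD; [apply: measurable_funD|]; exact: measurable_funM.
exists (3 * (N * N')); split; first exact: num_real.
move=> c /ltW hc x Dx /=; apply: le_trans hc; apply: (le_trans (dot_norm _ _)).
by rewrite ler_pM2l// ler_pM// ?HN ?HN'.
Qed.

Lemma field_ip_lin a u v w : bounded_field u -> bounded_field v -> bounded_field w ->
  field_ip (a *: u + v) w = a * field_ip u w + field_ip v w.
Proof.
move=> bu bv bw; have iu := integrable_field_dot bu bw; have iv := integrable_field_dot bv bw.
rewrite /field_ip -RintegralZl// -RintegralD//; last first.
  exact: (@integrableZl _ _ _ mu _ mD a _ iu).
by apply: eq_Rintegral => x _; rewrite !fctE dotDl dotZl.
Qed.

Lemma field_ip_sym u v : field_ip u v = field_ip v u.
Proof. by apply: eq_Rintegral => x _; exact: dotC. Qed.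

Lemma field_ip_ge0 u : 0 <= field_ip u u.
Proof.
by apply: Rintegral_ge0 => x _; rewrite /dot !addr_ge0// -expr2 sqr_ge0.
Qed.

(** A [get] satisfies the property defining its set once this set is inhabited, and
    [projection_exists] provides the element. *)
Lemma L2proj_field (V : set (E3 R -> E3 R)) (s : seq (E3 R -> E3 R)) w :
  (forall u, V u <-> lspan s u) -> (forall e, List.In e s -> bounded_field e) ->
  bounded_field w -> forall v, V v -> field_ip (L2proj field_ip V w) v = field_ip w v.
Proof.
move=> Vs bs bw v Vv.
have [q sq qE] := projection_exists bounded_field0 bounded_field_lin field_ip_lin
  (fun u v _ _ => field_ip_sym u v) (fun u _ => field_ip_ge0 u) bs bw.
have : exists q, [set q | V q /\ forall v, V v -> field_ip q v = field_ip w v] q.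
  by exists q; split; [exact/Vs|move=> v' /Vs; exact: qE].
by move/getPex => [_]; exact.
Qed.

End BoundedFields.

(** * Replacing the field by its projections *)

Section WeakDivergence.
Context {R : realType}.
Local Notation M2 := (measurableTypeR R * measurableTypeR R)%type.
Local Notation M3 := (M2 * measurableTypeR R)%type.
Variables (T : polyhedron R) (k : nat).

Lemma patch_lin (D : set (E3 R)) a (u v : E3 R -> R) x :
  ((a *: u + v) \_ D) x = a * (u \_ D) x + (v \_ D) x.
Proof. by rewrite !patchE; case: ifP => _ //; rewrite mulr0 addr0. Qed.

Lemma Pk_lin D a (u v : E3 R -> R) : Pk k D u -> Pk k D v ->
  Pk k D (fun x => a * u x + v x).
Proof.
move=> [p pp <-] [q qq <-]; exists (a *: p + q); first exact: polyfun_lin.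
by apply/funext => x; rewrite patch_lin.
Qed.

Lemma Pk0 D : Pk k D (fun=> 0 : R).
Proof. by exists 0; [exact: polyfun0|apply/funext => x; rewrite patchE if_same]. Qed.

Lemma lspan_image (phi : (E3 R -> R) -> (E3 R -> E3 R)) (s : seq (E3 R -> E3 R)) :
  (forall a u v, phi (a *: u + v) = a *: phi u + phi v) ->
  (forall e, List.In e (monomials k) -> lspan s (phi e)) ->
  forall u, polyfun k u -> lspan s (phi u).
Proof.
move=> lphi H u /polyfun_lspan.
apply: (@lspan_ind _ _ (monomials k) (fun u => lspan s (phi u))) => //.
- have -> : phi 0 = 0; last exact: lspan0.
  have := lphi (-1) 0 0; rewrite scaler0 addr0 scaleN1r addNr; exact.
- by move=> a f g sf sg; rewrite lphi; exact: lspan_lin.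
Qed.

Let vec1 (u : E3 R -> R) : E3 R -> E3 R := fun x => ((u \_ (region T)) x, 0, 0).
Let vec2 (u : E3 R -> R) : E3 R -> E3 R := fun x => (0, (u \_ (region T)) x, 0).
Let vec3 (u : E3 R -> R) : E3 R -> E3 R := fun x => (0, 0, (u \_ (region T)) x).
Let basis0 := map vec1 (monomials k) ++ (map vec2 (monomials k) ++ map vec3 (monomials k)).

Let vec1_lin a u v : vec1 (a *: u + v) = a *: vec1 u + vec1 v.
Proof.
by apply/funext => x; rewrite !fctE /vec1; apply: E3_eq; rewrite /= ?patch_lin /GRing.scale //= mulr0 addr0.
Qed.
Let vec2_lin a u v : vec2 (a *: u + v) = a *: vec2 u + vec2 v.
Proof.
by apply/funext => x; rewrite !fctE /vec2; apply: E3_eq; rewrite /= ?patch_lin /GRing.scale //= mulr0 addr0.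
Qed.
Let vec3_lin a u v : vec3 (a *: u + v) = a *: vec3 u + vec3 v.
Proof.
by apply/funext => x; rewrite !fctE /vec3; apply: E3_eq; rewrite /= ?patch_lin /GRing.scale //= mulr0 addr0.
Qed.

Let V0_lspan u : V0 k T u <-> lspan basis0 u.
Proof.
split.
- move=> [[u1 p1 E1] [u2 p2 E2] [u3 p3 E3']].
  have -> : u = 1 *: vec1 u1 + (1 *: vec2 u2 + (1 *: vec3 u3 + 0)).
    apply/funext => x; rewrite !fctE /vec1 /vec2 /vec3; apply: E3_eq;
      rewrite /= /GRing.scale /= !mulr0 ?addr0 ?add0r mul1r.
    + by rewrite E1.
    + by rewrite E2.
    + by rewrite E3'.
  apply: lspan_lin; last apply: lspan_lin; last (apply: lspan_lin; last exact: lspan0).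
  + apply: (@lspan_image vec1 basis0 vec1_lin _ _ p1) => e es; rewrite -[basis0]map_id.
    by apply: lspan_mem; apply/List.in_or_app; left; exact: List.in_map.
  + apply: (@lspan_image vec2 basis0 vec2_lin _ _ p2) => e es; rewrite -[basis0]map_id.
    apply: lspan_mem; apply/List.in_or_app; right; apply/List.in_or_app; left.
    exact: List.in_map.
  + apply: (@lspan_image vec3 basis0 vec3_lin _ _ p3) => e es; rewrite -[basis0]map_id.
    apply: lspan_mem; apply/List.in_or_app; right; apply/List.in_or_app; right.
    exact: List.in_map.
- move: u; apply: lspan_ind.
  + by split; exact: Pk0.
  + by move=> a f g [f1 f2 f3] [g1 g2 g3]; split; exact: Pk_lin.
  + move=> e /List.in_app_iff[|/List.in_app_iff[|]] h;
      have [p /monomials_polyfun pp ->] := In_map h;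
      by split; rewrite /vec1 /vec2 /vec3 /=; try exact: Pk0; exists p.
Qed.

Let mT : measurable (region T : set M3). Proof. exact: measurable_region. Qed.
Let fT : (leb3 (region T : set M3) < +oo)%E.
Proof. by apply: leb3_compact_lty; exact: ph_compact. Qed.

Let bounded_basis0 e : List.In e basis0 -> bounded_field (region T : set M3) id e.
Proof.
have mc (p : E3 R -> R) : polyfun k p -> measurable_fun (region T : set M3) (p \_ (region T)).
  move=> pp; apply: measurable_funTS; apply/(measurable_restrict _ _ _) => //.
  by apply: measurable_funTS; apply: measurable_elementary; exact: polyfun_elementary pp.
have bc (p : E3 R -> R) : polyfun k p -> exists2 N : R, 0 < N &
    forall x, region T x -> `|(p \_ (region T)) x| <= N.
  move=> pp; have [N N0 HN] := elementary_bound T (polyfun_elementary pp).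
  by exists N => // x Tx; rewrite patchE mem_set// HN.
move=> /List.in_app_iff[|/List.in_app_iff[|]] h;
  have [p /monomials_polyfun pp ->] := In_map h;
  have [N N0 HN] := bc p pp; (split; [..|exists (N + 0 + 0) => x Tx]).
all: try exact: mc.
all: try exact: measurable_cst.
all: rewrite /vec1 /vec2 /vec3; (have := HN _ Tx); rewrite !prod_normE /= !normr0 => hN;
  by rewrite !ge_max !addr0 ?hN ?(ltW N0).
Qed.

Variable (w : E3 R -> E3 R).
Hypothesis cw : {within region T, continuous w}.

Let bounded_w : bounded_field (region T : set M3) id w.
Proof.
have [w1 w2 w3] := measurable_continuous_field cw; split => //.
by have [N N0 HN] := continuous_field_bound cw; exists N.
Qed.

(** The field [v] is polynomial on the whole space; its truncation [v'] belongs to [V0], and the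
    inner product over [T] does not distinguish them. *)
Lemma proj_interior_ip (v : E3 R -> E3 R) : polyfun k (fun x => (v x).1.1) ->
  polyfun k (fun x => (v x).1.2) -> polyfun k (fun x => (v x).2) ->
  ipv T (L2proj (ipv T) (V0 k T) w) v = ipv T w v.
Proof.
move=> v1 v2 v3.
pose v' : E3 R -> E3 R := fun x => (((fun y => (v y).1.1) \_ (region T)) x,
  ((fun y => (v y).1.2) \_ (region T)) x, ((fun y => (v y).2) \_ (region T)) x).
have ev u : ipv T u v = ipv T u v'.
  apply: eq_Rintegral => x Tx; congr dot; apply: E3_eq; by rewrite /v' /= patchE Tx.
have Vv : V0 k T v' by split; [exists (fun y => (v y).1.1)|exists (fun y => (v y).1.2)|exists (fun y => (v y).2)].
rewrite !ev.
exact: (@L2proj_field _ _ _ leb3 (region T : set M3) mT fT id (V0 k T) basis0 w V0_lspan bounded_basis0 bounded_w).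
Qed.

Section Face.
Variables (i : 'I_(nfaces T)) (nu : E3 R).
Let F := ph_face i.
Let K : set M2 := fdom F.
Hypothesis hnu : unit_normal F nu.

Let vecf (u : E3 R -> R) : E3 R -> E3 R := fun x => (u \_ (face_set F)) x *: nu.
Let basisf := map vecf (monomials k).

Let vecf_lin a u v : vecf (a *: u + v) = a *: vecf u + vecf v.
Proof. by apply/funext => x; rewrite !fctE /vecf patch_lin scalerDl scalerA. Qed.

Let Vf_lspan u : Vf k F nu u <-> lspan basisf u.
Proof.
split.
- move=> [_ [p pp <-] ->]; apply: (@lspan_image vecf basisf vecf_lin _ _ pp) => e es.
  exact: lspan_mem.
- move: u; apply: lspan_ind.
  + exists (fun=> 0); first exact: Pk0.
    by apply/funext => x; rewrite scale0r.
  + move=> a f g [u pu ->] [v pv ->]; exists (fun x => a * u x + v x); first exact: Pk_lin.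
    by apply/funext => x; rewrite !fctE scalerDl scalerA.
  + move=> e h; have [p /monomials_polyfun pp ->] := In_map h.
    by exists (p \_ (face_set F)) => //; exists p.
Qed.

Let mK : measurable K. Proof. by apply: compact_measurable2; exact: fdom_compact. Qed.
Let fK : (leb2 K < +oo)%E.
Proof. by apply: leb2_compact_lty; exact: fdom_compact. Qed.

Let chart_region z : K z -> region T (chart F z).
Proof. by move=> Kz; have [] := @face_sub_boundary _ T i (chart F z); first by exists z. Qed.

Let bounded_normal (f : E3 R -> R) : measurable_fun K (fun z => f (chart F z)) ->
  (exists N : R, forall x, region T x -> `|f x| <= N) ->
  bounded_field K (chart F) (fun x => f x *: nu).
Proof.
move=> mf [N HN]; split.
- exact: measurable_funM.
- exact: measurable_funM.
- exact: measurable_funM.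
exists (N * `|nu|) => z Kz; rewrite normrZ ler_wpM2r// HN//; exact: chart_region.
Qed.

Let bounded_basisf e : List.In e basisf -> bounded_field K (chart F) e.
Proof.
move=> h; have [p /monomials_polyfun pp ->] := In_map h.
have ep := polyfun_elementary pp.
apply: bounded_normal; last first.
  have [N N0 HN] := elementary_bound T ep; exists N => x Tx.
  by rewrite patchE; case: ifP => _; rewrite ?normr0 ?HN ?ltW.
apply: (@eq_measurable_fun _ _ _ _ K (fun z => p (chart F z))).
  by move=> z Kz; rewrite patchE mem_set//; exists z => //; exact: set_mem.
apply: within_continuous_measurable2 => //; apply: continuous_subspaceT => z.
apply: (@continuous_comp _ _ _ (chart F) p); first exact: continuous_chart.
exact: continuous_elementary.
Qed.

Let bounded_wf : bounded_field K (chart F) (fun x => dot (w x) nu *: nu).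
Proof.
apply: bounded_normal.
  have [c1 c2 c3] := @continuous_E3 R.
  by apply: measurable_funD; [apply: measurable_funD|]; apply: measurable_funM => //;
    [exact: (measurable_chart_comp cw (i := i) c1)|exact: (measurable_chart_comp cw (i := i) c2)
    |exact: (measurable_chart_comp cw (i := i) c3)].
have [N N0 HN] := continuous_field_bound cw; exists (3 * (N * `|nu|)) => x Tx.
by apply: (le_trans (dot_norm _ _)); rewrite ler_pM2l// ler_wpM2r// HN.
Qed.

(** The outward normal is [s *: nu] for a sign [s], so [tau *: outward] agrees on the face with the
    element of [Vf] of coefficient [s *: tau]. The same sign turns [dot (w x) nu] back into the
    outward flux. *)
Lemma proj_face_ip (tau : E3 R -> R) : polyfun k tau ->
  ipf F (L2proj (ipf F) (Vf k F nu) (fun x => dot (w x) nu *: nu))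
    (fun x => tau x *: outward F) =
  \int[leb2]_(z in fdom F) (tau (chart F z) * dot (w (chart F z)) (outward F)).
Proof.
move=> pt; have [s ss nE] := unit_normalP hnu.
have oE : outward F = s *: nu by rewrite nE scalerA ss scale1r.
pose v := vecf (s *: tau).
have pst : polyfun k (s *: tau).
  by have := polyfun_lin s pt (polyfun0 k); rewrite addr0.
have ev u : ipf F u (fun x => tau x *: outward F) = ipf F u v.
  apply: eq_Rintegral => z Kz; congr dot.
  rewrite /v /vecf patchE mem_set; last by exists z => //; exact: set_mem.
  by rewrite fctE oE scalerA mulrC.
rewrite ev.
have Vv : Vf k F nu v by exists ((s *: tau) \_ (face_set F)) => //; exists (s *: tau).
rewrite [LHS](@L2proj_field _ _ _ leb2 K mK fK (chart F) (Vf k F nu) basisf _ Vf_lspan bounded_basisf bounded_wf)//.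
rewrite -[LHS]/(ipf F _ v) -ev; apply: eq_Rintegral => z _.
have n1 : dot nu nu = 1 by case: hnu.
rewrite oE dotZl !dotZr n1; ring.
Qed.

End Face.
End WeakDivergence.

Theorem lemma4p3 (R : realType) (T : polyhedron R) (k : nat)
    (nu : 'I_(nfaces T) -> E3 R)
    (hnu : forall i, unit_normal (ph_face i) (nu i))
    (w : E3 R -> E3 R)
    (hdiv : Hdiv T w)
    (hcont : {within region T, continuous w}) :
  weak_div k (Qh3 k nu w) = Qh4 k T (divL2 T w).
Proof.
have gw : is_div T w (divL2 T w).
  by case: hdiv => _ _ _ h; have := getPex h.
(* Green's formula with both projections inserted: the functional that defines the weak divergence
   is the inner product with the distributional divergence. *)
have rhs tau : polyfun k tau -> ip T (divL2 T w) tau =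
    - ipv T (Qh3 k nu w).1 (grad tau)
      + ipb (Qh3 k nu w).2 (fun i x => tau x *: outward (ph_face i)).
  move=> pt; rewrite (green hcont (polyfun_elementary pt) gw); congr (- _ + _).
    by rewrite [RHS]proj_interior_ip//; exact: polyfun_derive.
  apply: eq_bigr => i _; rewrite [RHS](@proj_face_ip _ T k w hcont i (nu i))//.
have patch_ip d tau : ip T d (tau \_ (region T)) = ip T d tau.
  by apply: eq_Rintegral => x Tx; rewrite patchE Tx.
(* Both sides are [get] of a subset of [V4 k T]. The two sets differ only in their tests,
   polynomials on the whole space against their truncations to [T], and these have the same inner
   products over [T]. *)
congr get; apply/seteqP; split => d [Vd dE]; split => //.
- by move=> _ [tau pt <-]; rewrite !patch_ip dE// rhs.
- move=> tau pt; rewrite -rhs// -(patch_ip d) -(patch_ip (divL2 T w)).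
  by apply: dE; exists tau.
Qed.
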